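(* Let $A=\mathbb{C}Q/I$ be a toupie algebra with $a>0$ and $D>1$. Let $$L=\langle t_h,\ z_{us}\ :\ 1\le h\le r,\ 1\le u\le a,\ \alpha^{(s)}\in {}_0\mathcal{B}_\omega\setminus Z\rangle\subseteq \mathrm{HH}^1(A).$$ Then $L$ is a solvable Lie ideal of $\mathrm{HH}^1(A)$. Moreover: (1) $S_1=\langle t_h: 1\le h\le r\rangle$ is an abelian Lie subalgebra, $L_2=\langle z_{us}: 1\le u\le a,\ \alpha^{(s)}\in{}_0\mathcal{B}_\omega\setminus Z\rangle$ is an abelian ideal, and $L=S_1\ltimes L_2$; (2) there is an isomorphism of Lie algebras $$\mathrm{HH}^1(A)\cong \langle C''_1\rangle\oplus \mathfrak{sl}_a(\mathbb{C})\ltimes (S_1\ltimes L_2),$$ where $\langle C''_1\rangle$ is the span of the elements $y_i$ and $\mathfrak{sl}_a(\mathbb{C})$ corresponds to the Lie subalgebra spanned by the $x_j$ and $w_{pq}$.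
   Context: A finite quiver $Q$ is a toupie quiver if it has a unique source $0$, a unique sink $\omega$, and every other vertex is the source of exactly one arrow and the target of exactly one arrow. Paths are composed left to right. A branch is a path from $0$ to $\omega$; the arrows of a branch $\alpha^{(i)}$ are $\alpha^i_0,\alpha^i_1,\dots$ in order, $\alpha^i_0$ starting at $0$. A toupie algebra is $A=\mathbb{C}Q/I$ with $Q$ toupie and $I$ an admissible ideal generated by monomial relations (paths inside one branch) and non-monomial relations (linear combinations of branches). Branches are numbered so that $Z=\{\alpha^{(1)},\dots,\alpha^{(a)}\}$ is the set of arrows from $0$ to $\omega$; $\alpha^{(a+1)},\dots,\alpha^{(a+l)}$ are the branches of length $\ge2$ in no relation; $\alpha^{(a+l+1)},\dots,\alpha^{(a+l+m)}$ are the branches containing monomial relations; the remaining $n$ branches are those involved in non-monomial relations. The non-monomial relations are taken with coefficient matrix in reduced row echelon form: $\rho_i=\alpha^{(k_i)}+\sum_{j>k_i}b_{ij}\alpha^{(j)}$. Let $e_x$ be the trivial path at $x$, $E=\mathbb{C}Q_0$, $D=\dim e_0Ae_\omega$, and ${}_0\mathcal{B}_\omega$ the set of classes of branches containing no monomial relation and different from all $\alpha^{(k_i)}$ (a basis of $e_0Ae_\omega$ containing $Z$). Let $Q_\rho$ be the graph whose vertices are the branches of length $\ge2$ containing no monomial relation, with an edge between two of them if some $\rho_i$ involves both; $Q_\rho^1,\dots,Q_\rho^r$ are its connected components. For an arrow $\gamma$ and $h\in e_{s(\gamma)}Ae_{t(\gamma)}$, $\gamma\|h$ is the $E$-bimodule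 map $\mathbb{C}Q_1\to A$ sending $\gamma$ to $h$ and other arrows to $0$. $\mathrm{HH}^1(A)$ is identified with the space of derivations of $A$ vanishing on $E$ (given by their values on arrows) modulo the span of the maps $\sum_{t(\gamma)=x}\gamma\|\gamma-\sum_{s(\gamma)=x}\gamma\|\gamma$, $x\in Q_0$; it is a Lie algebra with the Gerstenhaber bracket (the commutator of derivations). Define the classes: $y_i=\alpha^i_0\|\alpha^i_0$ for each branch $\alpha^{(i)}$ containing monomial relations ($C''_1=\{y_i\}$); $w_{pq}=\alpha^{(p)}\|\alpha^{(q)}$ for $p\ne q$ in $\{1,\dots,a\}$; $z_{us}=\alpha^{(u)}\|\alpha^{(s)}$ for $1\le u\le a$, $\alpha^{(s)}\in{}_0\mathcal{B}_\omega\setminus Z$; $x_j=\alpha^{(j)}\|\alpha^{(j)}-\alpha^{(1)}\|\alpha^{(1)}$, $2\le j\le a$; $t_k=\sum_{\alpha^{(i)}\in Q_\rho^k}\alpha^i_0\|\alpha^i_0$, $1\le k\le r$. These classes form a basis of $\mathrm{HH}^1(A)$, and $w_{pq}\mapsto E_{qp}$, $x_j\mapsto E_{jj}-E_{11}$ identifies their span $\langle x_j,w_{pq}\rangle$ with $\mathfrak{sl}_a(\mathbb{C})$. *)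

(* Defs.v *)
From HB Require Import structures.
From mathcomp Require Import all_boot all_order all_algebra.
From mathcomp Require Import complex Rstruct.
Set Implicit Arguments.
Unset Strict Implicit.
Unset Printing Implicit Defensive.
Import GRing.Theory.
Local Open Scope ring_scope.

Definition C : fieldType := (Rdefinitions.R)[i].

Section Toupie.

(* A toupie quiver is given by its branches: N branches, branch i has
   len i >= 1 arrows.  Vertices: the source 0, the sink omega, and the
   internal vertices (i,j), 0 < j < len i, of each branch. *)
Variables (N : nat) (len : 'I_N -> nat).

Definition K : nat := (\max_(i < N) len i)%N.

(* raw paths: inl true = e_0, inl false = e_omega,
   inr (i,j,k) = the segment of branch i from position j to position k
   (for j = k an internal vertex it is the trivial path there). *)
Definition rawpath := (bool + ('I_N * 'I_K.+1 * 'I_K.+1))%type.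

Definition rvalid (p : rawpath) : bool :=
  match p with
  | inl _ => true
  | inr (i, j, k) => ((j <= k <= len i) && ((j < k) || (0 < j < len i)))%N
  end.

Definition path := {p : rawpath | rvalid p}.

Definition rawvertex := (bool + ('I_N * 'I_K.+1))%type.
Definition vvalid (v : rawvertex) : bool :=
  match v with inl _ => true | inr (i, j) => (0 < j < len i)%N end.
Definition vertex := {v : rawvertex | vvalid v}.

Definition vtx (i : 'I_N) (j : nat) : rawvertex :=
  if j == 0%N then inl true else if j == len i then inl false
  else inr (i, inord j).

Definition src (p : path) : rawvertex :=
  match val p with inl b => inl b | inr (i, j, _) => vtx i j end.
Definition tgt (p : path) : rawvertex :=
  match val p with inl b => inl b | inr (i, _, k) => vtx i k end.

Definition cat_raw (p q : rawpath) : rawpath :=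
  match p, q with
  | inl _, _ => q
  | _, inl _ => p
  | inr (i, j, _), inr (_, _, k) => inr (i, j, k)
  end.

Definition pcat (p q : path) : option path :=
  if tgt p == src q then insub (cat_raw (val p) (val q)) else None.

Definition CQ := {ffun path -> C^o}.
Definition ep (p : path) : CQ := [ffun q => (q == p)%:R].
Definition mulCQ (f g : CQ) : CQ :=
  [ffun p => \sum_(q : path) \sum_(r : path)
               (if pcat q r == Some p then f q * g r else 0)].

Definition arrow := {a : 'I_N * 'I_K | (a.2 < len a.1)%N}.

Definition p0 : path := exist _ (inl true) isT.
Definition mkpath (p : rawpath) : path := insubd p0 p.
Definition apath (g : arrow) : path :=
  mkpath (inr ((val g).1, inord (val g).2, inord (val g).2.+1)).
Definition bpath (i : 'I_N) : path := mkpath (inr (i, ord0, inord (len i))).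
Definition bpath_nat (s : nat) : path := oapp bpath p0 (insub s : option 'I_N).

(* Relations: monomial relations mono r = (i,j,k) (the subpath of branch i
   from position j to k), and non-monomial relations
   rho_r = sum_s B r s alpha^(s), with pivots kp r. *)
Variables (nm : nat) (mono : 'I_nm -> 'I_N * 'I_K.+1 * 'I_K.+1).
Variables (nn : nat) (B : 'M[C]_(nn, N)) (kp : 'I_nn -> 'I_N).

Definition gen := ('I_nm + 'I_nn)%type.
Definition relCQ (g : gen) : CQ :=
  match g with
  | inl r => ep (mkpath (inr (mono r)))
  | inr r => \sum_(s < N) B r s *: ep (bpath s)
  end.

Definition inI (f : CQ) : Prop :=
  exists n (x y : 'I_n -> CQ) (g : 'I_n -> gen),
    f = \sum_(k < n) mulCQ (mulCQ (x k) (relCQ (g k))) (y k).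

Definition in_e0we (f : CQ) : Prop :=
  forall p, f p != 0 -> src p = inl true /\ tgt p = inl false.

(* D = dim e_0 A e_omega > 1 *)
Definition D_gt1 : Prop :=
  exists f g : CQ, [/\ in_e0we f, in_e0we g &
    forall c d : C, inI (c *: f + d *: g) -> c = 0 /\ d = 0].

(* E-bimodule maps CQ_1 -> CQ, given by their values on arrows *)
Definition DerD := {ffun arrow -> CQ}.

Definition cat3 (u w v : path) : option path :=
  obind (fun uw => pcat uw v) (pcat u w).

(* the derivation of CQ extending d : D(g1...gn) = sum_k g1..d(gk)..gn *)
Definition Dpath (d : DerD) (p : path) : CQ :=
  \sum_(u : path) \sum_(g : arrow) \sum_(v : path)
     (if cat3 u (apath g) v == Some p
      then mulCQ (mulCQ (ep u) (d g)) (ep v) else 0).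
Definition Dd (d : DerD) (f : CQ) : CQ := \sum_(p : path) f p *: Dpath d p.

Definition parallel (d : DerD) : Prop :=
  forall g p, d g p != 0 -> src p = src (apath g) /\ tgt p = tgt (apath g).

(* d defines a derivation of A = CQ/I vanishing on E *)
Definition isDer (d : DerD) : Prop :=
  parallel d /\ forall f, inI f -> inI (Dd d f).

Definition phi (x : vertex) : DerD :=
  [ffun g : arrow => (((tgt (apath g) == val x)%:R - (src (apath g) == val x)%:R : C)
               *: ep (apath g))].

(* equality of classes in HH^1(A) *)
Definition hheq (d d' : DerD) : Prop :=
  exists c : vertex -> C,
    forall f, inI (Dd (d - d' - \sum_(x : vertex) c x *: phi x) f).

(* Gerstenhaber bracket = commutator of derivations *)
Definition br (d d' : DerD) : DerD := [ffun g : arrow => Dd d (d' g) - Dd d' (d g)].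

Definition inspan (P : DerD -> Prop) (d : DerD) : Prop :=
  exists n (c : 'I_n -> C) (v : 'I_n -> DerD),
    (forall k, P (v k)) /\ d = \sum_(k < n) c k *: v k.

Definition inSub (P : DerD -> Prop) (d : DerD) : Prop :=
  exists d', inspan P d' /\ hheq d d'.

Definition is_ideal (P : DerD -> Prop) : Prop :=
  forall d l, isDer d -> inspan P l -> inSub P (br d l).
Definition is_subalgebra (P : DerD -> Prop) : Prop :=
  forall l l', inspan P l -> inspan P l' -> inSub P (br l l').
Definition is_abelian (P : DerD -> Prop) : Prop :=
  forall l l', inspan P l -> inspan P l' -> hheq (br l l') 0.
Fixpoint derived (P : DerD -> Prop) (k : nat) (d : DerD) : Prop :=
  match k with
  | 0 => isDer d /\ inSub P d
  | k'.+1 => isDer d /\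
      inSub (fun b => exists x y, [/\ derived P k' x, derived P k' y & b = br x y]) d
  end.
Definition is_solvable (P : DerD -> Prop) : Prop :=
  exists k, forall d, derived P k d -> hheq d 0.

Definition hasmono (i : 'I_N) : bool := [exists r, (mono r).1.1 == i].
Definition Qv (i : 'I_N) : bool := (1 < len i)%N && ~~ hasmono i.
Definition Qedge : rel 'I_N :=
  fun i j => [&& Qv i, Qv j & [exists r, (B r i != 0) && (B r j != 0)]].
Definition is_pivot (s : 'I_N) : bool := [exists r, kp r == s].
Definition B0w_nZ (s : 'I_N) : bool := [&& (1 < len s)%N, ~~ hasmono s & ~~ is_pivot s].

Definition first_arrows (P : pred 'I_N) : DerD :=
  [ffun g : arrow => if P (val g).1 && ((val g).2 == 0 :> nat) then ep (apath g) else 0].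
Definition ygen (i : 'I_N) : DerD := first_arrows (pred1 i).
Definition tgen (i : 'I_N) : DerD := first_arrows (fun j => Qv j && connect Qedge i j).
(* z_us = alpha^(u) || alpha^(s)   (branches 0..a-1 are the arrows of Z) *)
Definition zgen (u : nat) (s : 'I_N) : DerD :=
  [ffun g : arrow => if (val g).1 == u :> nat then ep (bpath s) else 0].
Definition xgen (j : nat) : DerD :=
  [ffun g : arrow => if (val g).1 == j :> nat then ep (apath g)
             else if (val g).1 == 0%N :> nat then - ep (apath g) else 0].
Definition wgen (p q : nat) : DerD :=
  [ffun g : arrow => if (val g).1 == p :> nat then ep (bpath_nat q) else 0].

Variable a : nat.

Definition Tgen (d : DerD) : Prop := exists i, Qv i /\ d = tgen i.
Definition Zgen (d : DerD) : Prop :=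
  exists (u : nat) (s : 'I_N), [/\ (u < a)%N, B0w_nZ s & d = zgen u s].
Definition Lgen (d : DerD) : Prop := Tgen d \/ Zgen d.
Definition Ygen (d : DerD) : Prop := exists i, hasmono i /\ d = ygen i.
Definition Mgen (d : DerD) : Prop :=
  (exists j : nat, (0 < j < a)%N /\ d = xgen j) \/
  (exists p q : nat, [/\ (p < a)%N, (q < a)%N, p != q & d = wgen p q]).

Definition Mcomb (dx : 'I_a -> C) (ew : 'I_a -> 'I_a -> C) : DerD :=
  \sum_(j < a | j != 0%N :> nat) dx j *: xgen j
  + \sum_(p < a) \sum_(q < a | q != p) ew p q *: wgen p q.
Definition E11 : 'M[C]_a :=
  \matrix_(r, c) (((r == 0%N :> nat) && (c == 0%N :> nat))%:R).
Definition mxcomb (dx : 'I_a -> C) (ew : 'I_a -> 'I_a -> C) : 'M[C]_a :=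
  \sum_(j < a | j != 0%N :> nat) dx j *: (delta_mx j j - E11)
  + \sum_(p < a) \sum_(q < a | q != p) ew p q *: delta_mx q p.

(* Standing assumptions: A = CQ/I is a toupie algebra in the normal form of
   the paper: branches 0..a-1 are exactly the arrows from 0 to omega (a > 0),
   monomial relations are paths of length >= 2 inside a branch, the
   non-monomial relations rho_r = alpha^(kp r) + sum_{s > kp r} B r s alpha^(s)
   have coefficient matrix in reduced row echelon form, are genuinely
   non-monomial, and involve only branches of length >= 2 without monomial
   relations. *)
Definition toupie_hyp : Prop :=
  [/\ (forall i, (0 < len i)%N),
      [/\ (0 < a)%N, (a <= N)%N & forall i : 'I_N, (len i == 1%N) = (i < a)%N],
      (forall r, let: (i, j, k) := mono r in (j.+2 <= k <= len i)%N),
      [/\ (forall r, B r (kp r) = 1),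
          (forall r (s : 'I_N), (s < kp r)%N -> B r s = 0),
          (forall r r', r != r' -> B r' (kp r) = 0) &
          (forall r r' : 'I_nn, (r < r')%N -> (kp r < kp r')%N)] &
      (forall r, exists s, s != kp r /\ B r s != 0)] /\
  (forall r s, B r s != 0 -> (1 < len s)%N /\ ~~ hasmono s).

End Toupie.

(* Main.v *)
Require Import Defs.
From HB Require Import structures.
From mathcomp Require Import all_boot all_order all_algebra.
From mathcomp Require Import complex Rstruct.
From mathcomp Require Import zify.
Import GRing.Theory.
Local Open Scope ring_scope.

(* For a derivation d vanishing on E, let S_i(d) be the sum of its diagonal
   coefficients along the branch i of length >= 2, and let Lam(d) be the matrix
   of d on the arrows from 0 to omega, with values in e_0 A e_omega.  Adding an
   inner derivation shifts all the S_i and the diagonal of Lam by one common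
   constant, and these coordinates modulo that shift determine the class of d in
   HH^1(A).  The S_i vanish on brackets, and the action of d on e_0 A e_omega is
   block triangular with blocks Lam and the diagonal matrix of the S_i, so Lam of
   a bracket is given by a matrix commutator.  Every claim then becomes one about
   such matrices. *)

Set Implicit Arguments.
Unset Strict Implicit.

(** * Paths as segments of branches *)

(** Because inner derivations shift the coordinates, an equality in HH^1 only gives equality of
    coordinates up to an unknown constant k, and k has to be eliminated before anything can be
    concluded. On the span of the x_j and w_pq the Z-block (rows and columns in Z) has trace zero,
    so k a = 0 and k = 0 in characteristic 0; on L the Z-block vanishes, and one diagonal entry
    gives k = 0. Conversely, the trace divided by a is the shift needed to decompose an arbitrary
    derivation. The S_i satisfy a single constraint: they agree on branches that occur together in
    some rho_r, hence on each component of Q_rho. A branch with a monomial relation vanishes in A,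
    so its S_i does not act on e_0 A e_omega; this is why the y_i are central. A bracket with an
    element of L has zero Z-block and therefore lands in L_2. In the derived series, elements are
    taken up to inner derivations, so scalar Z-blocks, and not only zero ones, have to be carried
    along. *)

Section Paths.
Variables (N : nat) (len : 'I_N -> nat).
Hypothesis len_gt0 : forall i, (0 < len i)%N.
Local Open Scope nat_scope.

Lemma len_leK i : len i <= K len.
Proof. exact: leq_bigmax. Qed.

(** For j = k at an end of the branch the [inr] form is rejected by [rvalid] and must become e_0 or
    e_omega; with this normalisation one formula covers all paths. *)
Definition rseg (i : 'I_N) (j k : nat) : rawpath len :=
  if j == k then
    if j == 0 then inl true else if j == len i then inl false
    else inr (i, inord j, inord j)
  else inr (i, inord j, inord k).

(* For j = k this is the trivial path at position j of branch i. *)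
Definition seg (i : 'I_N) (j k : nat) : Defs.path len := mkpath (rseg i j k).

Lemma inord_lenK i j : j <= len i -> (inord j : 'I_(K len).+1) = j :> nat.
Proof. by move=> h; rewrite inordK // ltnS (leq_trans h (len_leK i)). Qed.

Lemma val_seg i j k : j <= k <= len i -> val (seg i j k) = rseg i j k.
Proof.
move=> /andP[jk kl]; rewrite /seg /mkpath val_insubd.
suff -> : rvalid (rseg i j k) by [].
have jl := leq_trans jk kl.
rewrite /rseg; case: eqVneq => [ejk|njk].
  case: eqVneq => // j0; case: eqVneq => // jl' /=.
  by rewrite (inord_lenK jl) leqnn jl /= ltnn /=; lia.
by rewrite /rvalid (inord_lenK jl) (inord_lenK kl) jk kl /=; lia.
Qed.

Lemma vtx_inj i j i' j' : j <= len i -> j' <= len i' ->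
  vtx len i j = vtx len i' j' ->
  [\/ j = j' /\ i = i', j = 0 /\ j' = 0 | j = len i /\ j' = len i'].
Proof.
move=> jl jl'; rewrite /vtx.
case: (eqVneq j 0) => [->|j0]; case: (eqVneq j' 0) => [->|j0'].
- by constructor 2.
- by case: eqVneq.
- by case: eqVneq.
case: (eqVneq j (len i)) => [->|jl1]; case: (eqVneq j' (len i')) => [->|jl1'] //.
  by constructor 3.
case=> -> /(congr1 val) /=; rewrite (inord_lenK jl) (inord_lenK jl') => ->.
by constructor 1.
Qed.

Lemma vtx_inj1 i j k : j <= len i -> k <= len i ->
  vtx len i j = vtx len i k -> j = k.
Proof. by move=> jl kl /(vtx_inj jl kl)[[]|[-> ->]|[-> ->]]. Qed.

Lemma src_seg i j k : j <= k <= len i -> src (seg i j k) = vtx len i j.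
Proof.
move=> h; rewrite /src (val_seg h) /rseg /vtx.
case/andP: h => jk kl; have jl := leq_trans jk kl.
case: eqVneq => [_|njk]; last by rewrite /vtx (inord_lenK jl) .
case: eqVneq => // j0; case: eqVneq => // jl'.
by rewrite (inord_lenK jl) (negPf j0) (negPf jl').
Qed.

Lemma tgt_seg i j k : j <= k <= len i -> tgt (seg i j k) = vtx len i k.
Proof.
move=> h; rewrite /tgt (val_seg h) /rseg /vtx.
case/andP: h => jk kl; have jl := leq_trans jk kl.
case: eqVneq => [<-|njk]; last by rewrite /vtx (inord_lenK kl).
case: eqVneq => // j0; case: eqVneq => // jl'.
by rewrite (inord_lenK jl) (negPf j0) (negPf jl').
Qed.

Lemma path_seg (p : Defs.path len) i j k : val p = inr (i, j, k) -> p = seg i j k.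
Proof.
case: p => p vp /= ep; apply: val_inj; subst p.
case/andP: (vp) => /andP[jk kl] h /=.
rewrite [RHS]val_seg ?jk ?kl // /rseg; case: eqVneq => [e|ne]; last first.
  by rewrite !inord_val.
have -> : k = j by apply: val_inj.
rewrite -e ltnn /= in h.
by case: eqVneq => [e0|_]; [lia|case: eqVneq => [e0|_]; [lia|rewrite inord_val]].
Qed.

Lemma path_inr (p : Defs.path len) i j k : val p = inr (i, j, k) ->
  j <= k <= len i /\ ((j < k) || (0 < j < len i)).
Proof. by case: p => p vp /= ep; subst p; case/andP: vp. Qed.

(** From a vertex other than omega there is only one way back to 0, so the endpoint fixes the
    branch. For j = 0 the path is e_0, which is [seg i 0 0] on every branch. *)
Lemma path_tgt (u : Defs.path len) i j : j < len i -> tgt u = vtx len i j ->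
  exists2 j', j' <= j & u = seg i j' j.
Proof.
move=> jl; case eu: (val u) => [b|[[i' j'] k']]; rewrite /tgt eu.
  rewrite /vtx; case: eqVneq => [->|j0]; last by case: eqVneq => //; lia.
  case=> eb; exists 0 => //; apply: val_inj; rewrite val_seg // eu /rseg /=.
  by rewrite eb.
have [/andP[jk kl] h] := path_inr eu.
case/(vtx_inj kl (ltnW jl)) => [[e ei]|[e0 e1]|[e0 e1]]; try lia.
by subst i'; exists j'; rewrite -?e // (path_seg eu).
Qed.

(** The dual fact: from a vertex other than 0 there is only one way on, and e_omega is written at
    the end of branch i. *)
Lemma path_src (u : Defs.path len) i k : 0 < k <= len i -> src u = vtx len i k ->
  exists2 k', k <= k' <= len i & u = seg i k k'.
Proof.
move=> /andP[k0 kl]; case eu: (val u) => [b|[[i' j'] k']]; rewrite /src eu.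
  rewrite /vtx; case: eqVneq => [e|_]; first by lia.
  case: eqVneq => // -> [eb]; exists (len i); first by rewrite leqnn.
  apply: val_inj; rewrite val_seg ?leqnn // eu /rseg eqxx.
  by case: eqVneq => [e|_]; [have := len_gt0 i; lia|rewrite eb].
have [/andP[jk kl'] h] := path_inr eu.
have jl : j' <= len i' by lia.
case/(vtx_inj jl kl) => [[e ei]|[e0 e1]|[e0 e1]]; try lia.
by subst i'; exists k'; rewrite -?e ?jk // (path_seg eu).
Qed.

Lemma pcat_seg i j k l : j <= k -> k <= l -> l <= len i ->
  pcat (seg i j k) (seg i k l) = Some (seg i j l).
Proof.
move=> jk kl ll.
have h1 : j <= k <= len i by lia.
have h2 : k <= l <= len i by lia.
have h3 : j <= l <= len i by lia.
rewrite /pcat (tgt_seg h1) (src_seg h2) eqxx !val_seg //.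
suff -> : cat_raw (rseg i j k) (rseg i k l) = rseg i j l.
  by rewrite -(val_seg h3) valK.
rewrite /rseg; have := len_gt0 i => l0.
case: (eqVneq j k) => [?|njk].
  subst k; case: (eqVneq j 0) => // j0; case: (eqVneq j (len i)) => [e|nl].
    by have -> : (j == l) by lia.
  by case: (eqVneq j l).
case: (eqVneq k l) => [?|nkl]; last by have -> : (j == l) = false by lia.
subst l; rewrite (negPf njk).
by case: eqVneq => [?|_]; [lia|case: eqVneq].
Qed.

(** One segment has to be nontrivial: the trivial paths at 0 and omega are shared by all
    branches. *)
Lemma seg_inj i j k i' j' k' : j < k <= len i -> j' <= k' <= len i' ->
  seg i j k = seg i' j' k' -> [/\ i = i', j = j' & k = k'].
Proof.
move=> h h' /(congr1 val); rewrite !val_seg; try lia.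
rewrite /rseg; have -> : (j == k) = false by lia.
case: eqVneq => [?|n]; first (subst k'; case: eqVneq => // _; case: eqVneq => // _).
  case=> ei /(congr1 val) /= + /(congr1 val) /=; subst i'.
  by rewrite !(@inord_lenK i); lia.
case=> ei /(congr1 val) /= + /(congr1 val) /=; subst i'.
by rewrite !(@inord_lenK i); [move=> -> -> | lia..].
Qed.

Lemma src_pcat (p q r : Defs.path len) : pcat p q = Some r -> tgt p = src q.
Proof. by rewrite /pcat; case: eqP. Qed.

Definition abr (g : arrow len) : 'I_N := (val g).1.
Definition apos (g : arrow len) : nat := (val g).2.
Arguments abr : simpl never.
Arguments apos : simpl never.

Lemma apath_seg (g : arrow len) :
  apath g = seg (abr g) (apos g) (apos g).+1.
Proof.
by rewrite /abr /apos /apath /seg /rseg; case: eqVneq => // e; exfalso; move: e; lia.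
Qed.

Lemma bpath_seg i : bpath len i = seg i 0 (len i).
Proof.
rewrite /bpath /seg /rseg; have := len_gt0 i; case: eqVneq => [<-|_ _] //.
by congr (mkpath (inr (_, _, _))); apply: val_inj; rewrite /= (@inord_lenK i).
Qed.

Lemma arrow_lt (g : arrow len) : apos g < len (abr g).
Proof. exact: (valP g). Qed.

Lemma bpath_inj : injective (bpath len).
Proof.
move=> i j; rewrite !bpath_seg => /seg_inj h.
by case: h => //; rewrite ?leqnn ?len_gt0.
Qed.

Lemma arrow_inj (g g' : arrow len) : abr g = abr g' -> apos g = apos g' -> g = g'.
Proof.
rewrite /abr /apos => e1 e2; apply: val_inj.
case: (val g) (val g') e1 e2 => [i j] [i' j'] /= -> e2.
by congr pair; apply: val_inj.
Qed.

Lemma path_source_sink (p : Defs.path len) :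
  src p = inl true -> tgt p = inl false -> exists s, p = bpath len s.
Proof.
case ep: (val p) => [b|[[i j] k]]; rewrite /src /tgt ep; first by case=> ->.
have [/andP[jk kl] h] := path_inr ep => e1 e2.
exists i; rewrite bpath_seg (path_seg ep).
have h1 : vtx len i j = vtx len i 0 by rewrite e1.
have h2 : vtx len i k = vtx len i (len i).
  by rewrite e2 /vtx eqxx; have := len_gt0 i; case: eqVneq => [->|].
have jl : j <= len i by lia.
by congr seg; [exact: vtx_inj1 h1|exact: vtx_inj1 h2].
Qed.

Lemma path_source (i : 'I_N) (u : Defs.path len) :
  tgt u = inl true -> u = seg i 0 0.
Proof.
by move=> h; have [|j'] := @path_tgt u i 0 (len_gt0 i); rewrite ?h // leqn0 => /eqP->.
Qed.

(** The branch [i0] serves to write e_0 and e_omega as segments. *)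
Lemma path_segP (i0 : 'I_N) (p : Defs.path len) :
  exists i j k, j <= k <= len i /\ p = seg i j k.
Proof.
case ep: (val p) => [b|[[i j] k]]; last first.
  have [h _] := path_inr ep; exists i, j, k; split=> //; exact: path_seg ep.
exists i0, (if b then 0 else len i0), (if b then 0 else len i0).
split; first by case: b {ep}; rewrite leqnn.
apply: val_inj; rewrite [RHS]val_seg ?ep; last by case: b {ep}; rewrite leqnn.
by rewrite /rseg; case: b {ep} => //; rewrite !eqxx; case: eqVneq (len_gt0 i0) => // ->.
Qed.

End Paths.

(** * The path algebra and the extension of a derivation to paths *)

Section PathAlgebra.
Variables (N : nat) (len : 'I_N -> nat).
Hypothesis len_gt0 : forall i, (0 < len i)%N.

Local Notation CQ := (CQ len).
Implicit Types f g h : CQ.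

Lemma mulCQDl f g h : mulCQ (f + g) h = mulCQ f h + mulCQ g h.
Proof.
apply/ffunP => p; rewrite !ffunE -big_split; apply: eq_bigr => q _ /=.
rewrite -big_split; apply: eq_bigr => r _ /=; case: ifP; rewrite ?addr0 //.
by rewrite ffunE mulrDl.
Qed.

Lemma mulCQDr f g h : mulCQ f (g + h) = mulCQ f g + mulCQ f h.
Proof.
apply/ffunP => p; rewrite !ffunE -big_split; apply: eq_bigr => q _ /=.
rewrite -big_split; apply: eq_bigr => r _ /=; case: ifP; rewrite ?addr0 //.
by rewrite ffunE mulrDr.
Qed.

Lemma mulCQZl c f g : mulCQ (c *: f) g = c *: mulCQ f g.
Proof.
apply/ffunP => p; rewrite !ffunE scaler_sumr; apply: eq_bigr => q _ /=.
rewrite scaler_sumr; apply: eq_bigr => r _ /=; case: ifP; rewrite ?scaler0 //.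
by rewrite ffunE -scalerAl.
Qed.

Lemma mulCQZr c f g : mulCQ f (c *: g) = c *: mulCQ f g.
Proof.
apply/ffunP => p; rewrite !ffunE scaler_sumr; apply: eq_bigr => q _ /=.
rewrite scaler_sumr; apply: eq_bigr => r _ /=; case: ifP; rewrite ?scaler0 //.
by rewrite ffunE -scalerAr.
Qed.

Lemma mul0CQ f : mulCQ 0 f = 0.
Proof. by have := mulCQZl 0 0 f; rewrite !scale0r. Qed.

Lemma mulCQ0 f : mulCQ f 0 = 0.
Proof. by have := mulCQZr 0 f 0; rewrite !scale0r. Qed.

Lemma mulCQ_suml (I : finType) (P : pred I) (F : I -> CQ) g :
  mulCQ (\sum_(i | P i) F i) g = \sum_(i | P i) mulCQ (F i) g.
Proof.
exact: (big_morph (fun f => mulCQ f g) (fun f h => mulCQDl f h g) (mul0CQ g)).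
Qed.

Lemma mulCQ_sumr (I : finType) (P : pred I) (F : I -> CQ) f :
  mulCQ f (\sum_(i | P i) F i) = \sum_(i | P i) mulCQ f (F i).
Proof.
exact: (big_morph (mulCQ f) (mulCQDr f) (mulCQ0 f)).
Qed.

Lemma CQ_sum_ep f : f = \sum_p f p *: ep p.
Proof.
apply/ffunP => q; rewrite sum_ffunE (bigD1 q) //= big1 => [|p /negPf npq].
  by rewrite !ffunE eqxx addr0 [_ *: _]mulr1.
by rewrite !ffunE eq_sym npq scaler0.
Qed.

Lemma mulCQ_ep (p q : Defs.path len) :
  mulCQ (ep p) (ep q) = oapp (@ep N len) 0 (pcat p q).
Proof.
apply/ffunP => r; rewrite ffunE (bigD1 p) //= [X in _ + X]big1 => [|p' np]; last first.
  by apply: big1 => q' _; rewrite !ffunE (negPf np) mul0r if_same.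
rewrite addr0 (bigD1 q) //= [X in _ + X]big1 => [|q' nq]; last first.
  by rewrite !ffunE (negPf nq) mulr0 if_same.
rewrite addr0 !ffunE !eqxx mulr1; case: (pcat p q) => [s|]; rewrite /= ffunE //.
by rewrite (inj_eq Some_inj) eq_sym; case: eqP.
Qed.

Lemma mulCQ_seg i j k l : (j <= k)%N -> (k <= l)%N -> (l <= len i)%N ->
  mulCQ (ep (seg len i j k)) (ep (seg len i k l)) = ep (seg len i j l).
Proof. by move=> *; rewrite mulCQ_ep pcat_seg. Qed.

Lemma mulCQ_segl (u : Defs.path len) i j k : (j < k <= len i)%N ->
  mulCQ (ep u) (ep (seg len i j k)) = 0 \/
  exists2 j', (j' <= j)%N & u = seg len i j' j.
Proof.
move=> h; rewrite mulCQ_ep; case e: pcat => [r|]; [right|by left].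
apply: path_tgt; first lia.
by rewrite (src_pcat e) src_seg //; lia.
Qed.

Lemma mulCQ_segr (v : Defs.path len) i j k : (j < k <= len i)%N ->
  mulCQ (ep (seg len i j k)) (ep v) = 0 \/
  exists2 k', (k <= k' <= len i)%N & v = seg len i k k'.
Proof.
move=> h; rewrite mulCQ_ep; case e: pcat => [r|]; [right|by left].
apply: (path_src len_gt0); first lia.
by rewrite -(src_pcat e) tgt_seg //; lia.
Qed.

(** Only e_0 ends at 0 and only e_omega starts at omega, so multiplying a branch by paths returns it
    or kills it. The coefficient is independent of s, hence the identity passes to combinations of
    branches such as rho_r. *)
Lemma mulCQ_bpath u s v :
  mulCQ (mulCQ (ep u) (ep (bpath len s))) (ep v) =
  ((tgt u == inl true) && (src v == inl false))%:R *: ep (bpath len s).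
Proof.
have l0 := len_gt0 s.
have sb : src (bpath len s) = inl true by rewrite bpath_seg // src_seg // leqnn.
have tb : tgt (bpath len s) = inl false.
  by rewrite bpath_seg // tgt_seg /vtx ?leqnn // eqxx; case: eqVneq l0 => // ->.
case: eqVneq => [tu|ntu]; last first.
  by rewrite mulCQ_ep /pcat sb (negPf ntu) mul0CQ scale0r.
case: eqVneq => [sv|nsv].
  rewrite scale1r (path_source len_gt0 s tu) bpath_seg // mulCQ_seg //.
  have [||k' /andP[k1 k2] ->] := @path_src _ _ len_gt0 v s (len s).
  - by rewrite l0 leqnn.
  - by rewrite sv -tb bpath_seg // tgt_seg // leqnn.
  have -> : k' = len s by lia.
  by rewrite mulCQ_seg.
rewrite scale0r (path_source len_gt0 s tu) [in ep (bpath _ _)]bpath_seg //.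
rewrite mulCQ_seg // -bpath_seg // mulCQ_ep /pcat tb.
by rewrite eq_sym (negPf nsv).
Qed.

(** The source of an arrow is not omega and its target is not 0, so both outer factors are forced
    onto the branch of g. *)
Lemma cat3_apath (u : Defs.path len) (g : arrow len) v p : cat3 u (apath g) v = Some p ->
  exists j' k', [/\ (j' <= apos g)%N, (apos g < k' <= len (abr g))%N,
    u = seg len (abr g) j' (apos g), v = seg len (abr g) (apos g).+1 k' &
    p = seg len (abr g) j' k'].
Proof.
rewrite /cat3; have gl := arrow_lt g.
case e : pcat => [w|] //= e'.
have [|j' hj' hu] := @path_tgt _ _ u _ _ gl.
  by rewrite (src_pcat e) apath_seg src_seg // leqnSn.
move: e; rewrite hu apath_seg pcat_seg // => -[ew].
have [||k' hk' hv] := @path_src _ _ len_gt0 v (abr g) (apos g).+1; first by [].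
  by rewrite -(src_pcat e') -ew tgt_seg //; lia.
move: e'; rewrite hv -ew pcat_seg //; try lia.
by case=> <-; exists j', k'.
Qed.

(** A path contains each arrow at most once, and the arrow determines the two outer factors; the sum
    over all factorizations thus becomes a sum over the arrows of the segment. *)
Lemma Dpath_seg (d : DerD len) i j k : (j < k <= len i)%N ->
  Dpath d (seg len i j k) =
  \sum_(g : arrow len | (abr g == i) && (j <= apos g < k)%N)
    mulCQ (mulCQ (ep (seg len i j (apos g))) (d g))
          (ep (seg len i (apos g).+1 k)).
Proof.
move=> h; rewrite /Dpath exchange_big [RHS]big_mkcond /=; apply: eq_bigr => g _.
have uniqP u v : cat3 u (apath g) v = Some (seg len i j k) ->
  [/\ abr g == i, (j <= apos g < k)%N, u = seg len i j (apos g) &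
      v = seg len i (apos g).+1 k].
  case/cat3_apath => j' [k'] [h1 h2 -> ->] /seg_inj[//||-> -> ->].
    by lia.
  by rewrite eqxx; split=> //; lia.
have gl := arrow_lt g.
case: ifP => [/andP[/eqP ei hg]|ng]; last first.
  apply: big1 => u _; apply: big1 => v _; case: eqP => // /uniqP[h1 h2].
  by rewrite h1 h2 in ng.
rewrite (bigD1 (seg len i j (apos g))) //= [X in _ + X]big1 ?addr0; last first.
  by move=> u nu; apply: big1 => v _; case: eqP => // /uniqP[_ _ eu]; rewrite eu eqxx in nu.
rewrite (bigD1 (seg len i (apos g).+1 k)) //= [X in _ + X]big1 ?addr0; last first.
  by move=> v nv; case: eqP => // /uniqP[_ _ _ ev]; rewrite ev eqxx in nv.
rewrite /cat3 apath_seg ei pcat_seg //=; try lia.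
by rewrite pcat_seg ?eqxx //; lia.
Qed.

Lemma Dpath_trivial (d : DerD len) i j : (j <= len i)%N -> Dpath d (seg len i j j) = 0.
Proof.
move=> jl; apply: big1 => u _; apply: big1 => g _; apply: big1 => v _.
by case: eqP => // /cat3_apath[j' [k' [h1 h2 _ _ /esym/seg_inj[]]]]; lia.
Qed.

Lemma DdD d f g : Dd d (f + g) = Dd d f + Dd d g.
Proof.
rewrite -big_split; apply: eq_bigr => p _ /=.
by rewrite ffunE scalerDl.
Qed.

Lemma DdZ (d : DerD len) c f : Dd d (c *: f) = c *: Dd d f.
Proof.
rewrite scaler_sumr; apply: eq_bigr => p _ /=.
by rewrite ffunE scalerA.
Qed.

Lemma Dd0 (d : DerD len) : Dd d 0 = 0.
Proof. by have := DdZ d 0 0; rewrite !scale0r. Qed.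

Lemma Dd_sum d (I : finType) (P : pred I) (F : I -> CQ) :
  Dd d (\sum_(i | P i) F i) = \sum_(i | P i) Dd d (F i).
Proof. exact: (big_morph (Dd d) (DdD d) (Dd0 d)). Qed.

Lemma Dd_ep (d : DerD len) p : Dd d (ep p) = Dpath d p.
Proof.
rewrite /Dd (bigD1 p) //= big1 => [|q nq]; first by rewrite ffunE eqxx scale1r addr0.
by rewrite ffunE (negPf nq) scale0r.
Qed.

(** * Diagonal coefficients along a branch *)

Definition diag (d : DerD len) (g : arrow len) : C := d g (apath g).

(** This is S_i; on a branch of length at least 2 it is the eigenvalue of the derivation at that
    branch. *)
Definition bsum (i : 'I_N) (d : DerD len) : C :=
  \sum_(g : arrow len | abr g == i) diag d g.

Lemma CQ_diag f (p : Defs.path len) : (forall q, f q != 0 -> q = p) -> f = f p *: ep p.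
Proof.
move=> h; apply/ffunP => q; rewrite !ffunE; case: eqVneq => [->|nq].
  by rewrite [RHS]mulr1.
by rewrite scaler0; apply: contraNeq nq => /h ->.
Qed.

(** An arrow outside Z has an interior vertex as one of its ends, and this end fixes the branch of
    any parallel path. *)
Lemma parallel_diag (d : DerD len) (g : arrow len) : parallel d -> (1 < len (abr g))%N ->
  d g = diag d g *: ep (apath g).
Proof.
move=> pd l1; apply: CQ_diag => q /pd[].
have gl := arrow_lt g.
rewrite apath_seg src_seg ?tgt_seg ?leqnSn ?arrow_lt // => sq tq.
(* The last arrow ends at omega, but its source is interior since the branch has length at least 2;
   any other arrow has an interior target. *)
move: gl; rewrite leq_eqVlt => /orP[/eqP e|lt].
  have [||k' hk' hq] := @path_src _ _ len_gt0 q (abr g) (apos g); try by [lia|].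
  move: tq; rewrite hq tgt_seg // => /vtx_inj1 -> //; try lia.
have [||j' hj' hq] := @path_tgt _ _ q (abr g) (apos g).+1; try by [lia|].
move: sq; rewrite hq src_seg; last by lia.
by move/vtx_inj1 => -> //; lia.
Qed.

Lemma parallel_Z (d : DerD len) (g : arrow len) : parallel d -> len (abr g) = 1%N ->
  d g = \sum_s d g (bpath len s) *: ep (bpath len s).
Proof.
move=> pd l1; have gl := arrow_lt g.
have g0 : apos g = 0%N :> nat by lia.
apply/ffunP => q; rewrite sum_ffunE.
case: (pickP (fun s => q == bpath len s)) => [s /eqP ->|nq].
  rewrite (bigD1 s) //= [X in _ + X]big1 ?addr0 => [|s' ns].
    by rewrite !ffunE eqxx [RHS]mulr1.
  by rewrite !ffunE (inj_eq (bpath_inj len_gt0)) eq_sym (negPf ns) scaler0.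
rewrite [RHS]big1 => [|s _]; last by rewrite !ffunE nq scaler0.
apply/eqP; apply: contraT => /pd[].
rewrite apath_seg src_seg ?tgt_seg ?leqnSn ?arrow_lt // g0 => sq.
rewrite {1}/vtx l1 /= => tq; have [s es] := path_source_sink len_gt0 sq tq.
by have := nq s; rewrite es eqxx.
Qed.

Lemma Dpath_parallel d i j k : parallel d -> (1 < len i)%N -> (j < k <= len i)%N ->
  Dpath d (seg len i j k) =
  (\sum_(g : arrow len | (abr g == i) && (j <= apos g < k)%N) diag d g)
   *: ep (seg len i j k).
Proof.
move=> pd l1 h; rewrite Dpath_seg // scaler_suml; apply: eq_bigr => g /andP[/eqP ei hg].
rewrite parallel_diag ?ei // mulCQZr mulCQZl apath_seg ei.
by rewrite !mulCQ_seg //; lia.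
Qed.

Lemma Dpath_apath (d : DerD len) (g : arrow len) : parallel d -> (1 < len (abr g))%N ->
  Dpath d (apath g) = diag d g *: ep (apath g).
Proof.
move=> pd l1; have gl := arrow_lt g.
rewrite apath_seg Dpath_parallel //; last by lia.
rewrite (big_pred1 g) // => g'; apply/idP/eqP => [/andP[/eqP e hg]|->].
  by apply: arrow_inj => //; lia.
by rewrite eqxx leqnn ltnSn.
Qed.

Lemma Dpath_bpath d i : parallel d -> (1 < len i)%N ->
  Dpath d (bpath len i) = bsum i d *: ep (bpath len i).
Proof.
move=> pd l1; have h : (0 < len i <= len i)%N by rewrite len_gt0 leqnn.
rewrite bpath_seg // (Dpath_parallel pd l1 h); congr (_ *: _).
apply: eq_bigl => g; case: eqVneq => //= <-; exact: arrow_lt.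
Qed.

Lemma Dpath_bpathZ (d : DerD len) (g : arrow len) : parallel d -> len (abr g) = 1%N ->
  Dpath d (bpath len (abr g)) = d g.
Proof.
move=> pd l1; have gl := arrow_lt g.
have g0 : apos g = 0%N :> nat by lia.
rewrite bpath_seg // Dpath_seg ?l1 // (big_pred1 g) => [|g'].
  rewrite g0 [RHS](parallel_Z pd l1) {1}(parallel_Z pd l1).
  have tu : tgt (seg len (abr g) 0 0) == inl true by rewrite tgt_seg.
  have sv : src (seg len (abr g) 1 1) == inl false.
    by rewrite src_seg ?l1 // /vtx l1.
  rewrite mulCQ_sumr mulCQ_suml; apply: eq_bigr => s _.
  by rewrite mulCQZr mulCQZl mulCQ_bpath tu sv scale1r.
apply/idP/eqP => [/andP[/eqP e hg]|->]; last by rewrite eqxx g0.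
by apply: arrow_inj => //; lia.
Qed.

End PathAlgebra.

(** * Coordinates modulo the ideal of relations *)

Section Ideal.
Variables (N : nat) (len : 'I_N -> nat).
Variables (nm : nat) (mono : 'I_nm -> 'I_N * 'I_(K len).+1 * 'I_(K len).+1).
Variables (nn : nat) (B : 'M[C]_(nn, N)) (kp : 'I_nn -> 'I_N) (a : nat).
Hypothesis tH : toupie_hyp mono B kp a.

Local Notation CQ := (CQ len).
Local Notation inI := (inI mono B).
Implicit Types f g h : CQ.

Lemma branch_gt0 i : (0 < len i)%N.
Proof. by case: tH => -[h]. Qed.

Lemma a_gt0 : (0 < a)%N.
Proof. by case: tH => -[_ [h]]. Qed.

Lemma a_leN : (a <= N)%N.
Proof. by case: tH => -[_ [_ h]]. Qed.

Lemma branch1 i : (len i == 1%N) = (i < a)%N.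
Proof. by case: tH => -[_ [_ _ ->]]. Qed.

Lemma branch_gt1 (i : 'I_N) : (1 < len i)%N = (a <= i)%N.
Proof. by have := branch1 i; have := branch_gt0 i; lia. Qed.

Lemma mono_bounds r : ((mono r).1.2.+2 <= (mono r).2 <= len (mono r).1.1)%N.
Proof. by case: tH => -[_ _ /(_ r)]; case: (mono r) => -[i j] k. Qed.

Lemma B_pivot r : B r (kp r) = 1.
Proof. by case: tH => -[_ _ _ []]. Qed.

Lemma B_pivot_other r r' : r != r' -> B r' (kp r) = 0.
Proof. by case: tH => -[_ _ _ [_ _ h _] _] _; apply: h. Qed.

Lemma B_other r : exists s, s != kp r /\ B r s != 0.
Proof. by case: tH => -[_ _ _ _ h] _; apply: h. Qed.

Lemma B_support r s : B r s != 0 -> (1 < len s)%N && ~~ hasmono mono s.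
Proof. by case: tH => _ h /h [-> ->]. Qed.

Definition rho (r : 'I_nn) : CQ := \sum_(s < N) B r s *: ep (bpath len s).

Lemma relCQ_mono r :
  relCQ mono B (inl r) = ep (seg len (mono r).1.1 (mono r).1.2 (mono r).2).
Proof.
have := mono_bounds r; rewrite /relCQ; case: (mono r) => -[i j] k /= h.
rewrite /seg /rseg; have -> : (j == k :> nat) = false by lia.
by rewrite !inord_val.
Qed.

Lemma inI_gen x (g : gen nm nn) y : inI (mulCQ (mulCQ x (relCQ mono B g)) y).
Proof. by exists 1%N, (fun=> x), (fun=> y), (fun=> g); rewrite big_ord1. Qed.

Lemma inI0 : inI 0.
Proof.
exists 0%N, (fun=> 0), (fun=> 0), (fun i : 'I_0 => match notF (ltn_ord i) with end).
by rewrite big_ord0.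
Qed.

Lemma inID f g : inI f -> inI g -> inI (f + g).
Proof.
move=> [n [x [y [e ->]]]] [n' [x' [y' [e' ->]]]].
pose glue T (u : 'I_n -> T) (u' : 'I_n' -> T) (k : 'I_(n + n')) :=
  match split k with inl i => u i | inr i => u' i end.
exists (n + n')%N, (glue _ x x'), (glue _ y y'), (glue _ e e').
rewrite big_split_ord /glue /=; congr (_ + _); apply: eq_bigr => k _.
  by rewrite (unsplitK (inl k)).
by rewrite (unsplitK (inr k)).
Qed.

Lemma inIZ c f : inI f -> inI (c *: f).
Proof.
move=> [n [x [y [e ->]]]]; exists n, (fun k => c *: x k), y, e.
by rewrite scaler_sumr; apply: eq_bigr => k _; rewrite !mulCQZl.
Qed.

Lemma inI_sum (I : finType) (P : pred I) (F : I -> CQ) :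
  (forall i, P i -> inI (F i)) -> inI (\sum_(i | P i) F i).
Proof. by move=> h; elim/big_ind: _ => //; [exact: inI0|exact: inID]. Qed.

Lemma inI_mono r j k : (j <= (mono r).1.2)%N ->
  ((mono r).2 <= k <= len (mono r).1.1)%N -> inI (ep (seg len (mono r).1.1 j k)).
Proof.
have hb := mono_bounds r => h1 h2; have l0 := branch_gt0.
rewrite -(@mulCQ_seg _ _ l0 _ j (mono r).2 k); try lia.
rewrite -(@mulCQ_seg _ _ l0 _ j (mono r).1.2 (mono r).2); try lia.
rewrite -relCQ_mono; exact: inI_gen.
Qed.

Lemma inI_rho r : inI (rho r).
Proof.
have [i0 _] := B_other r.
(* Elements of I are sums of two-sided products, so rho_r is written as e_0 rho_r e_omega. *)
have -> : rho r = mulCQ (mulCQ (ep (mkpath (inl true))) (rho r)) (ep (mkpath (inl false))).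
  rewrite mulCQ_sumr mulCQ_suml; apply: eq_bigr => s _.
  rewrite mulCQZr mulCQZl (mulCQ_bpath branch_gt0).
  by rewrite /tgt /src !val_insubd /= ?eqxx scale1r.
exact: (inI_gen _ (inr r) _).
Qed.

(* A relation multiplied by paths on both sides is zero, a rho_r, or a path through
   a monomial relation; so these elements span I, and no Leibniz rule is needed to
   check that a derivation preserves I. *)
Lemma inI_ind (P : CQ -> Prop) :
  P 0 -> (forall f g, P f -> P g -> P (f + g)) ->
  (forall c f, P f -> P (c *: f)) ->
  (forall r j k, (j <= (mono r).1.2)%N -> ((mono r).2 <= k <= len (mono r).1.1)%N ->
     P (ep (seg len (mono r).1.1 j k))) ->
  (forall r, P (rho r)) -> forall f, inI f -> P f.
Proof.
move=> P0 PD PZ Pm Pr f [n [x [y [e ->]]]].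
have Psum (I : finType) (F : I -> CQ) : (forall i, P (F i)) -> P (\sum_i F i).
  by move=> h; elim/big_ind: _.
apply: (Psum) => k; rewrite (CQ_sum_ep (x k)) (CQ_sum_ep (y k)).
rewrite !mulCQ_suml; apply: (Psum) => u; rewrite mulCQ_sumr; apply: (Psum) => v.
rewrite mulCQZr !mulCQZl; do 2!apply: (PZ).
case: (e k) => r; last first.
  rewrite mulCQ_sumr mulCQ_suml.
  rewrite (eq_bigr (fun s => ((tgt u == inl true) && (src v == inl false))%:R *:
             (B r s *: ep (bpath len s)))) => [|s _]; last first.
    by rewrite mulCQZr mulCQZl (mulCQ_bpath branch_gt0) !scalerA mulrC.
  by rewrite -scaler_sumr; apply: PZ; apply: Pr.
have hb := mono_bounds r; rewrite relCQ_mono.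
case: (@mulCQ_segl _ len u (mono r).1.1 (mono r).1.2 (mono r).2) => [||[j hj ->]].
- by lia.
- by move=> ->; rewrite mul0CQ.
rewrite (mulCQ_seg branch_gt0); try lia.
case: (@mulCQ_segr _ len branch_gt0 v (mono r).1.1 j (mono r).2) => [||[l hl ->]].
- by lia.
- by move=> ->.
by rewrite (mulCQ_seg branch_gt0); [apply: Pm|lia..].
Qed.

(** * Coordinates on e_0 A e_omega *)

Lemma ep_bpath s t : (ep (bpath len s)) (bpath len t) = (s == t)%:R :> C.
Proof. by rewrite ffunE (inj_eq (bpath_inj branch_gt0)) eq_sym. Qed.

Lemma sum_bpathE (F : 'I_N -> C) t :
  (\sum_s F s *: ep (bpath len s) : CQ) (bpath len t) = F t.
Proof.
rewrite sum_ffunE (bigD1 t) //= big1 => [|s ns].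
  by rewrite ffunE ep_bpath eqxx addr0 [LHS]mulr1.
by rewrite ffunE ep_bpath (negPf ns) scaler0.
Qed.

(** These are the branches of the basis of e_0 A e_omega, Z included; [B0w_nZ] keeps those of length
    at least 2. *)
Definition good s := ~~ hasmono mono s && ~~ is_pivot kp s.

(* For good s, the coordinate of f at the basis element alpha^(s) of e_0 A e_omega. *)
Definition lam s f : C := f (bpath len s) - \sum_r B r s * f (bpath len (kp r)).

Lemma goodE s : good s = ~~ hasmono mono s && ~~ is_pivot kp s.
Proof. by []. Qed.

Lemma lamE s f :
  lam s f = f (bpath len s) - \sum_r B r s * f (bpath len (kp r)).
Proof. by []. Qed.

Lemma lamD s f g : lam s (f + g) = lam s f + lam s g.
Proof.
rewrite /lam ffunE addrACA -opprD -big_split /=; congr (_ - _).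
by apply: eq_bigr => r _; rewrite ffunE mulrDr.
Qed.

Lemma lamZ s c f : lam s (c *: f) = c * lam s f.
Proof.
rewrite /lam mulrBr ffunE mulr_sumr; congr (_ - _).
by apply: eq_bigr => r _; rewrite ffunE mulrCA.
Qed.

Lemma lam0 s : lam s 0 = 0.
Proof. by have := lamZ s 0 0; rewrite scale0r mul0r. Qed.

Lemma lam_sum s (I : finType) (P : pred I) (F : I -> CQ) :
  lam s (\sum_(i | P i) F i) = \sum_(i | P i) lam s (F i).
Proof. exact: (big_morph (lam s) (lamD s) (lam0 s)). Qed.

Lemma lam_bpath s t : ~~ is_pivot kp t -> lam s (ep (bpath len t)) = (s == t)%:R.
Proof.
move=> npt; rewrite /lam ep_bpath eq_sym big1 ?subr0 // => r _.
rewrite ep_bpath; case: eqP => [e|]; last by rewrite mulr0.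
by case/existsP: npt; exists r; rewrite e.
Qed.

Lemma hasmono_pivot r : hasmono mono (kp r) = false.
Proof.
have /B_support/andP[_ /negPf //] : B r (kp r) != 0.
by rewrite B_pivot oner_neq0.
Qed.

(** On rho_r the value is B r s minus the sum over r' of B r' s B r (kp r'), where the reduced
    echelon form leaves only r' = r. A path through a monomial relation is neither a good branch nor
    a pivot branch. *)
Lemma inI_lam f s : good s -> inI f -> lam s f = 0.
Proof.
move=> /andP[ms ps]; elim/inI_ind => [|g h gP hP|c g gP|r j k hj hk|r].
- exact: lam0.
- by rewrite lamD gP hP addr0.
- by rewrite lamZ gP mulr0.
- have hm t : ~~ hasmono mono t -> ep (seg len (mono r).1.1 j k) (bpath len t) = 0.
    move=> mt; rewrite ffunE; case: eqP => //; rewrite (bpath_seg branch_gt0).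
    have hb := mono_bounds r; have l0 := branch_gt0 t.
    case/seg_inj; [lia..|] => et _ _.
    by case/existsP: mt; exists r; rewrite et.
  rewrite /lam hm // big1 ?subr0 // => r' _; rewrite hm ?mulr0 //.
  by rewrite hasmono_pivot.
rewrite /lam sum_bpathE (bigD1 r) //= sum_bpathE B_pivot mulr1 big1 ?addr0 ?subrr //.
by move=> r' nr; rewrite sum_bpathE B_pivot_other ?mulr0.
Qed.

(** This is admissibility: monomial relations have length at least 2, and each rho_r involves only
    branches of length at least 2. *)
Lemma inI_arrow f (g : arrow len) : inI f -> f (apath g) = 0.
Proof.
have gl := arrow_lt g.
elim/inI_ind => [|h h' gP hP|c h gP|r j k hj hk|r].
- by rewrite ffunE.
- by rewrite ffunE gP hP addr0.
- by rewrite ffunE gP scaler0.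
- rewrite ffunE apath_seg; case: eqP => // /seg_inj[]; have := mono_bounds r; lia.
rewrite sum_ffunE big1 // => s _; rewrite !ffunE.
case: (eqVneq (B r s) 0) => [->|/B_support/andP[l1 _]]; first by rewrite scale0r.
rewrite apath_seg (bpath_seg branch_gt0).
by case: eqP => [/seg_inj[]|_]; rewrite ?scaler0 //; lia.
Qed.

Lemma inI_bpath_mono s : hasmono mono s -> inI (ep (bpath len s)).
Proof.
case/existsP => r /eqP <-; rewrite (bpath_seg branch_gt0).
by apply: inI_mono; have := mono_bounds r; lia.
Qed.

Lemma is_pivotP s : reflect (exists r, s = kp r) (is_pivot kp s).
Proof.
by apply: (iffP existsP) => [[r /eqP <-]|[r ->]]; exists r.
Qed.

(** Subtracting F (kp r) rho_r for every r clears the pivot branches and leaves the [lam]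
    coordinates on the good ones; the remaining branches contain monomial relations and lie in I. *)
Lemma lam_inI (F : 'I_N -> C) :
  (forall s, good s -> lam s (\sum_s F s *: ep (bpath len s)) = 0) ->
  inI (\sum_s F s *: ep (bpath len s)).
Proof.
move=> h; set f := \sum_s _ in h *.
rewrite -(subrK (\sum_r F (kp r) *: rho r) f); apply: inID; last first.
  by apply: inI_sum => r _; apply/inIZ/inI_rho.
have -> : f - \sum_r F (kp r) *: rho r =
    \sum_s (F s - \sum_r B r s * F (kp r)) *: ep (bpath len s).
  rewrite (eq_bigr (fun s => F s *: ep (bpath len s) -
      \sum_r (F (kp r) *: (B r s *: ep (bpath len s))))) => [|s _]; last first.
    rewrite scalerBl scaler_suml; congr (_ - _); apply: eq_bigr => r _.
    by rewrite scalerA mulrC.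
  rewrite sumrB exchange_big /=; congr (_ - _); apply: eq_bigr => r _.
  by rewrite scaler_sumr.
apply: inI_sum => s _.
case: (boolP (hasmono mono s)) => [ms|ms]; first exact/inIZ/inI_bpath_mono.
suff -> : F s - \sum_r B r s * F (kp r) = 0 by rewrite scale0r; apply: inI0.
case: (is_pivotP s) => [[r0 ->]|ps].
  rewrite (bigD1 r0) //= B_pivot mul1r big1 ?addr0 ?subrr // => r nr.
  by rewrite B_pivot_other ?mul0r // eq_sym.
have gs : good s by rewrite /good ms; apply/is_pivotP.
apply: etrans (h s gs); rewrite /lam /f sum_bpathE; congr (_ - _); apply: eq_bigr => r _.
by rewrite sum_bpathE.
Qed.

End Ideal.

(** * Coordinates of a derivation and equality in HH^1 *)

Section Coordinates.
Variables (N : nat) (len : 'I_N -> nat).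
Variables (nm : nat) (mono : 'I_nm -> 'I_N * 'I_(K len).+1 * 'I_(K len).+1).
Variables (nn : nat) (B : 'M[C]_(nn, N)) (kp : 'I_nn -> 'I_N) (a : nat).
Hypothesis tH : toupie_hyp mono B kp a.

Local Notation CQ := (CQ len).
Local Notation inI := (inI mono B).
Local Notation lam := (@lam N len nn B kp).
Local Notation good := (good mono kp).
Let len_gt0 := branch_gt0 tH.
Implicit Types (d e : DerD len) (f : CQ).

Definition zbr (u : 'I_a) : 'I_N := widen_ord (a_leN tH) u.

Lemma zbr_len u : len (zbr u) = 1%N.
Proof. by apply/eqP; rewrite (branch1 tH) /= ltn_ord. Qed.

Lemma zbr_inj : injective zbr.
Proof. by move=> u v /(congr1 val) /= h; apply: val_inj. Qed.

Lemma arrow_at_subproof i (t : 'I_(len i)) : (t < K len)%N.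
Proof. by apply: leq_trans (ltn_ord t) _; apply: len_leK. Qed.

Definition arrow_at i (t : 'I_(len i)) : arrow len :=
  exist _ (i, Ordinal (arrow_at_subproof t)) (ltn_ord t).

Definition zarr (u : 'I_a) : arrow len := arrow_at (Ordinal (len_gt0 (zbr u))).

Lemma abr_zarr u : abr (zarr u) = zbr u. Proof. by []. Qed.

Lemma apath_zarr u : apath (zarr u) = bpath len (zbr u).
Proof. by rewrite apath_seg (bpath_seg len_gt0) zbr_len. Qed.

Lemma zarrP (g : arrow len) : len (abr g) = 1%N -> exists u, g = zarr u.
Proof.
move=> l1; have ga : (abr g < a)%N by rewrite -(branch1 tH) l1.
exists (Ordinal ga); apply: arrow_inj; first by apply: val_inj.
by have := arrow_lt g; rewrite l1 /=; case: (apos g).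
Qed.

Lemma arrowP (g : arrow len) : (1 < len (abr g))%N \/ exists u, g = zarr u.
Proof.
by have := len_gt0 (abr g); rewrite leq_eqVlt => /orP[/eqP/esym/zarrP|]; [right|left].
Qed.

Lemma branchP (i : 'I_N) : (1 < len i)%N \/ exists u, i = zbr u.
Proof.
case: (boolP (len i == 1%N)) => [l1|l1]; last by left; have := len_gt0 i; lia.
have ia : (i < a)%N by rewrite -(branch1 tH).
by right; exists (Ordinal ia); apply: val_inj.
Qed.

Lemma good_zbr u : good (zbr u).
Proof.
apply/andP; split.
  apply/existsP => -[r /eqP e]; have := mono_bounds tH r.
  by rewrite e zbr_len; lia.
apply/existsP => -[r /eqP e].
have /(B_support tH)/andP[] : B r (kp r) != 0 by rewrite (B_pivot tH) oner_neq0.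
by rewrite e zbr_len.
Qed.

Lemma sum_branch i (F : nat -> C) :
  \sum_(g : arrow len | abr g == i) F (apos g) = \sum_(0 <= t < len i) F t.
Proof.
rewrite (eq_bigr (fun g => \sum_(t < len i | apos g == t) F t)) => [|g /eqP gi].
  rewrite (exchange_big_dep xpredT) //= big_mkord; apply: eq_bigr => t _.
  by rewrite (big_pred1 (arrow_at t)).
have gl := arrow_lt g; rewrite gi in gl.
by rewrite (big_pred1 (Ordinal gl)).
Qed.

(** Row s, column u: the coordinate at alpha^(s) of the image of alpha^(u). In this order
    composition on the Z-block is the matrix product, and w_pq becomes E_qp. *)
Definition Lam (s : 'I_N) (u : 'I_a) d : C := lam s (d (zarr u)).

Lemma LamE s u d : Lam s u d = lam s (d (zarr u)).
Proof. by []. Qed.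

Lemma LamD s u d e : Lam s u (d + e) = Lam s u d + Lam s u e.
Proof. by rewrite /Lam ffunE lamD. Qed.

Lemma LamZ s u c d : Lam s u (c *: d) = c * Lam s u d.
Proof. by rewrite /Lam ffunE lamZ. Qed.

Lemma diagD g d e : diag (d + e) g = diag d g + diag e g.
Proof. by rewrite /diag !ffunE. Qed.

Lemma diagZ g c d : diag (c *: d) g = c * diag d g.
Proof. by rewrite /diag !ffunE. Qed.

Lemma bsumD i d e : bsum i (d + e) = bsum i d + bsum i e.
Proof. by rewrite -big_split; apply: eq_bigr => g _; apply: diagD. Qed.

Lemma bsumZ i c d : bsum i (c *: d) = c * bsum i d.
Proof. by rewrite mulr_sumr; apply: eq_bigr => g _; apply: diagZ. Qed.

Lemma parallel0 : parallel (0 : DerD len).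
Proof. by move=> g p; rewrite !ffunE eqxx. Qed.

Lemma parallelD d e : parallel d -> parallel e -> parallel (d + e).
Proof.
move=> pd pe g p; rewrite !ffunE; case: (eqVneq (d g p) 0) => [->|/pd //].
by rewrite add0r; apply: pe.
Qed.

Lemma parallelZ c d : parallel d -> parallel (c *: d).
Proof.
move=> pd g p; rewrite !ffunE; case: (eqVneq (d g p) 0) => [->|/pd //].
by rewrite scaler0 eqxx.
Qed.

Lemma parallelN d : parallel d -> parallel (- d).
Proof. by rewrite -scaleN1r; apply: parallelZ. Qed.

Lemma parallel_ffun_scale (F : arrow len -> C) :
  parallel [ffun g => F g *: ep (apath g)].
Proof.
move=> g p; rewrite !ffunE; case: (eqVneq p (apath g)) => [->//|_].
by rewrite scaler0 eqxx.
Qed.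

Lemma zarr_span d u : parallel d ->
  d (zarr u) = \sum_s d (zarr u) (bpath len s) *: ep (bpath len s).
Proof. by move=> pd; apply: (parallel_Z len_gt0) => //; rewrite abr_zarr zbr_len. Qed.

Lemma Dpath_zbr d u : parallel d -> Dpath d (bpath len (zbr u)) = d (zarr u).
Proof. by move=> pd; rewrite -(abr_zarr u) (Dpath_bpathZ len_gt0) // abr_zarr zbr_len. Qed.

(** Arrows outside Z have nonzero class in A, so their diagonal coefficients can be read off modulo
    I; images of Z-arrows are tested by their coordinates on e_0 A e_omega. These data suffice,
    since any other path is multiplied by a sum of diagonal coefficients. *)
Lemma Dd_inI d : parallel d ->
  (forall f, inI (Dd d f)) <->
  (forall g, (1 < len (abr g))%N -> diag d g = 0) /\
  (forall s u, good s -> Lam s u d = 0).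
Proof.
move=> pd; split=> [h|[h1 h2] f].
  split=> [g l1|s u gs].
    have := h (ep (apath g)); rewrite Dd_ep (Dpath_apath len_gt0) // => /(inI_arrow tH g).
    by rewrite !ffunE eqxx; move=> <-; rewrite [RHS]mulr1.
  have := h (ep (bpath len (zbr u))); rewrite Dd_ep Dpath_zbr //.
  exact: (inI_lam tH).
apply: inI_sum => p _; apply: inIZ.
have [i [j [k [/andP[jk kl] ->]]]] := path_segP len_gt0 (zbr (Ordinal (a_gt0 tH))) p.
move: jk; rewrite leq_eqVlt => /orP[/eqP ejk|jk]; first subst k.
  by rewrite (Dpath_trivial len_gt0); [apply: inI0|lia].
case: (branchP i) => [l1|[u eu]].
  rewrite (Dpath_parallel len_gt0) ?jk // big1 ?scale0r; first exact: inI0.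
  by move=> g /andP[/eqP e _]; apply: h1; rewrite e.
have l1 := zbr_len u; rewrite -eu in l1.
have -> : seg len i j k = bpath len (zbr u).
  by rewrite (bpath_seg len_gt0) zbr_len -eu; congr seg; lia.
rewrite Dpath_zbr // zarr_span //; apply: (lam_inI tH) => s gs.
by rewrite -zarr_span //; apply: h2.
Qed.

(** * Inner derivations as differences of a potential *)

Definition inner (c : vertex len -> C) : DerD len := \sum_x c x *: phi x.

(** Extends [c] from vertices to raw vertices, so that it can be evaluated at sources and targets of
    paths. *)
Definition pot (c : vertex len -> C) (v : rawvertex len) : C :=
  \sum_x (v == val x)%:R * c x.

Lemma innerE c g : inner c g = (pot c (tgt (apath g)) - pot c (src (apath g))) *: ep (apath g).
Proof.
rewrite /inner /pot sum_ffunE -sumrB scaler_suml; apply: eq_bigr => x _.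
by rewrite !ffunE scalerA mulrC mulrBl.
Qed.

Lemma parallel_inner c : parallel (inner c).
Proof.
have -> : inner c = [ffun g => (pot c (tgt (apath g)) - pot c (src (apath g))) *: ep (apath g)].
  by apply/ffunP => g; rewrite innerE ffunE.
exact: parallel_ffun_scale.
Qed.

Lemma diag_inner c g :
  diag (inner c) g = pot c (vtx len (abr g) (apos g).+1) - pot c (vtx len (abr g) (apos g)).
Proof.
have gl := arrow_lt g.
rewrite /diag innerE !ffunE eqxx [LHS]mulr1 apath_seg tgt_seg ?src_seg //;
  by rewrite leqnSn.
Qed.

Lemma vtx0 i : vtx len i 0 = inl true. Proof. by []. Qed.

Lemma vtx_len i : vtx len i (len i) = inl false.
Proof. by rewrite /vtx eqxx; case: eqVneq (len_gt0 i) => // ->. Qed.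

Lemma bsum_inner c i : bsum i (inner c) = pot c (inl false) - pot c (inl true).
Proof.
rewrite -(vtx_len i) -(vtx0 i) -(telescope_sumr (fun t => pot c (vtx len i t)) (leq0n _)).
rewrite -(sum_branch i (fun t => pot c (vtx len i t.+1) - pot c (vtx len i t))).
by apply: eq_bigr => g /eqP <-; rewrite diag_inner.
Qed.

Lemma Lam_inner c s u :
  Lam s u (inner c) = (pot c (inl false) - pot c (inl true)) * (s == zbr u)%:R.
Proof.
rewrite /Lam innerE apath_seg tgt_seg ?src_seg; [|by rewrite leqnSn arrow_lt..].
have -> : (apos (zarr u)).+1 = len (abr (zarr u)) by rewrite abr_zarr zbr_len.
rewrite vtx_len vtx0 -(bpath_seg len_gt0) lamZ abr_zarr (lam_bpath tH) //.
by have /andP[] := good_zbr u.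
Qed.

Lemma pot_vtx (F : rawvertex len -> C) i j : (j <= len i)%N ->
  pot (fun x => F (val x)) (vtx len i j) = F (vtx len i j).
Proof.
move=> jl; have hv : vvalid (vtx len i j).
  rewrite /vtx; case: eqVneq => // j0; case: eqVneq => // jl' /=.
  by rewrite (inord_lenK jl); lia.
pose x0 : vertex len := exist (fun v => vvalid v) _ hv.
rewrite /pot (bigD1 x0) //= eqxx mul1r big1 ?addr0 // => x nx.
case: eqP => [e|]; last by rewrite mul0r.
by case/eqP: nx; apply: val_inj; rewrite /= -e.
Qed.

Lemma hheq_sub d d' : hheq mono B d d' <-> hheq mono B (d - d') 0.
Proof. by rewrite /hheq subr0. Qed.

(** Inner derivations give differences that telescope along branches. Conversely, integrating the
    diagonal coefficients along each branch of length at least 2 yields a potential, single-valued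
    at omega exactly because all these S_i equal k. *)
Lemma hheq0P d : parallel d -> hheq mono B d 0 <->
  exists k : C, (forall i, (1 < len i)%N -> bsum i d = k) /\
    (forall s u, good s -> Lam s u d = k * (s == zbr u)%:R).
Proof.
move=> pd.
have Bd c : parallel (d - inner c) by apply/parallelD/parallelN/parallel_inner.
have diagB c g : diag (d - inner c) g = diag d g - diag (inner c) g.
  by rewrite diagD -scaleN1r diagZ mulN1r.
have LamB c s u : Lam s u (d - inner c) = Lam s u d - Lam s u (inner c).
  by rewrite LamD -scaleN1r LamZ mulN1r.
split=> [[c hc]|[k [h1 h2]]].
  have /(Dd_inI (Bd c))[h1 h2] : forall f, inI (Dd (d - inner c) f).
    by move=> f; have := hc f; rewrite subr0.
  exists (pot c (inl false) - pot c (inl true)); split=> [i l1|s u gs].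
    rewrite -(bsum_inner c i); apply: eq_bigr => g /eqP gi.
    by apply/eqP; rewrite -subr_eq0 -diagB h1 // gi.
  by apply/eqP; rewrite -Lam_inner -subr_eq0 -LamB h2.
pose F (v : rawvertex len) : C := match v with
  | inl b => if b then 0 else k
  | inr (i, j) => \sum_(g : arrow len | (abr g == i) && (apos g < j)%N) diag d g
  end.
exists (fun x => F (val x)); rewrite subr0; apply/(Dd_inI (Bd _)).
have F0 : pot (fun x => F (val x)) (inl true) = 0.
  by rewrite -(vtx0 (zbr (Ordinal (a_gt0 tH)))) pot_vtx.
have Fk : pot (fun x => F (val x)) (inl false) = k.
  by rewrite -(vtx_len (zbr (Ordinal (a_gt0 tH)))) pot_vtx // vtx_len.
split=> [g l1|s u gs]; last by rewrite LamB Lam_inner F0 Fk subr0 h2 ?subrr.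
have gl := arrow_lt g.
have FE j : (j <= len (abr g))%N -> F (vtx len (abr g) j) =
    \sum_(g' : arrow len | (abr g' == abr g) && (apos g' < j)%N) diag d g'.
  move=> jl; rewrite /vtx; case: eqVneq => [->|j0].
    by rewrite /= big1 // => g'; rewrite andbF.
  case: eqVneq => [->|jl'] /=; last by rewrite (inord_lenK jl).
  rewrite -(h1 _ l1); apply: eq_bigl => g'.
  by case: eqVneq => //= <-; rewrite arrow_lt.
rewrite diagB diag_inner !pot_vtx ?FE //; [|lia..].
rewrite [X in _ - (X - _)](bigD1 g) /=; last by rewrite eqxx ltnSn.
rewrite [X in _ - (_ + X - _)](eq_bigl (fun g' => (abr g' == abr g) && (apos g' < apos g)%N)).
  by rewrite addrK subrr.
move=> g' /=; case: (eqVneq (abr g') (abr g)) => //= e.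
rewrite ltnS leq_eqVlt; case: (eqVneq g' g) => [->|ng]; first by rewrite eqxx ltnn.
rewrite andbT; case: eqP => //= e'.
by rewrite (arrow_inj e e') eqxx in ng.
Qed.

End Coordinates.
Arguments zbr_inj {N len nm mono nn B kp a} tH.

(** * Derivations of A and their brackets *)

Section Derivations.
Variables (N : nat) (len : 'I_N -> nat).
Variables (nm : nat) (mono : 'I_nm -> 'I_N * 'I_(K len).+1 * 'I_(K len).+1).
Variables (nn : nat) (B : 'M[C]_(nn, N)) (kp : 'I_nn -> 'I_N) (a : nat).
Hypothesis tH : toupie_hyp mono B kp a.

Local Notation CQ := (CQ len).
Local Notation inI := (inI mono B).
Local Notation lam := (@lam N len nn B kp).
Local Notation good := (good mono kp).
Local Notation zbr := (zbr tH).
Local Notation zarr := (zarr tH).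
Local Notation Lam := (Lam tH).
Local Notation nZ := (B0w_nZ mono kp).
Local Notation isDer := (isDer mono B).
Implicit Types (d e : DerD len) (f : CQ).

Lemma src_bpath s : src (bpath len s) = inl true.
Proof. by rewrite (bpath_seg (branch_gt0 tH)) src_seg // leqnn. Qed.

Lemma tgt_bpath s : tgt (bpath len s) = inl false.
Proof. by rewrite (bpath_seg (branch_gt0 tH)) tgt_seg ?leqnn // (vtx_len tH). Qed.

Lemma in_e0we_lin c f f' : in_e0we f -> in_e0we f' -> in_e0we (c *: f + f').
Proof.
move=> h h' p; rewrite !ffunE; case: (eqVneq (f p) 0) => [->|/h //].
by rewrite scaler0 add0r; apply: h'.
Qed.

Lemma in_e0we_sum (I : finType) (F : I -> C) (f : I -> CQ) :
  (forall i, in_e0we (f i)) -> in_e0we (\sum_i F i *: f i).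
Proof.
move=> h; elim/big_rec: _ => [p|i f' _ h']; first by rewrite ffunE eqxx.
exact: in_e0we_lin.
Qed.

Lemma in_e0we_ep s : in_e0we (ep (bpath len s)).
Proof.
move=> p; rewrite ffunE; case: (eqVneq p (bpath len s)) => [->|_]; last by rewrite eqxx.
by rewrite src_bpath tgt_bpath.
Qed.

Lemma in_e0we_zarr d u : parallel d -> in_e0we (d (zarr u)).
Proof. by move=> pd p /pd; rewrite apath_zarr src_bpath tgt_bpath. Qed.

Lemma Dpath_e0we d s : parallel d -> in_e0we (Dpath d (bpath len s)).
Proof.
move=> pd; case: (branchP tH s) => [l1|[u ->]]; last first.
  by rewrite (Dpath_zbr tH u pd); apply: in_e0we_zarr.
rewrite (Dpath_bpath (branch_gt0 tH)) // -[_ *: _]addr0; apply: in_e0we_lin.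
  exact: in_e0we_ep.
by move=> p; rewrite ffunE eqxx.
Qed.

Lemma Dd_zarr d d' u : parallel d' ->
  Dd d (d' (zarr u)) = \sum_s d' (zarr u) (bpath len s) *: Dpath d (bpath len s).
Proof.
move=> pd; rewrite {1}(zarr_span tH u pd) Dd_sum; apply: eq_bigr => s _.
by rewrite DdZ Dd_ep.
Qed.

(** Outside Z both maps act on arrows by scalars, which commute. *)
Lemma br_nonZ d d' (g : arrow len) : parallel d -> parallel d' ->
  (1 < len (abr g))%N -> br d d' g = 0.
Proof.
have l0 := branch_gt0 tH; move=> pd pd' l1.
rewrite ffunE (parallel_diag l0 pd l1) (parallel_diag l0 pd' l1) !DdZ !Dd_ep.
by rewrite !(Dpath_apath l0) // !scalerA mulrC subrr.
Qed.

Lemma parallel_br d d' : parallel d -> parallel d' -> parallel (br d d').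
Proof.
move=> pd pd' g p; case: (arrowP tH g) => [l1|[u ->]].
  by rewrite br_nonZ // ffunE eqxx.
rewrite apath_zarr src_bpath tgt_bpath; move: p; rewrite ffunE !Dd_zarr //.
rewrite -[X in X - _]scale1r -scaleN1r.
rewrite addrC; apply: in_e0we_lin; first by apply: in_e0we_sum => s; apply: Dpath_e0we.
by rewrite scale1r; apply: in_e0we_sum => s; apply: Dpath_e0we.
Qed.

Lemma bsum_br d d' i : parallel d -> parallel d' -> (1 < len i)%N ->
  bsum i (br d d') = 0.
Proof.
move=> pd pd' l1; apply: big1 => g /eqP gi.
by rewrite /diag br_nonZ ?gi // ffunE.
Qed.

Lemma sum_good (F : 'I_N -> C) :
  \sum_(t | good t) F t = \sum_u F (zbr u) + \sum_(t | nZ t) F t.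
Proof.
rewrite (bigID (fun t => len t == 1%N)) /=; congr (_ + _).
  rewrite (eq_bigr (fun t => \sum_(u | t == zbr u) F t)) => [|t /andP[_ /eqP lt]].
    rewrite (exchange_big_dep xpredT) //=; apply: eq_bigr => u _.
    apply: big_pred1 => t; rewrite /= andbC; case: eqVneq => //= ->.
    by rewrite (good_zbr tH) (zbr_len tH).
  case: (branchP tH t) => [|[u ->]]; first by rewrite lt.
  by rewrite (big_pred1 u) // => v; rewrite /= (inj_eq (zbr_inj tH)) eq_sym.
apply: eq_bigl => t; rewrite /good /B0w_nZ andbC; congr (_ && _).
by have := branch_gt0 tH t; lia.
Qed.

(** A derivation of A preserves I, so f may be replaced by its normal form on the good branches
    before the derivation is applied. *)
Lemma lam_Dd d s (F : 'I_N -> C) : isDer d -> good s ->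
  let f := \sum_t F t *: ep (bpath len t) in
  lam s (Dd d f) = \sum_(t | good t) lam s (Dpath d (bpath len t)) * lam t f.
Proof.
move=> [pd hd] gs f.
(* Coefficients of f minus its normal form: all good coordinates of this difference vanish, so it
   lies in I. *)
pose G t := F t - (if good t then lam t f else 0).
have GE : \sum_t G t *: ep (bpath len t) = f - \sum_(t | good t) lam t f *: ep (bpath len t).
  rewrite [X in _ - X]big_mkcond -sumrB; apply: eq_bigr => t _ /=.
  by rewrite /G scalerBl; case: (good t); [|rewrite scale0r].
have /hd/(inI_lam tH gs) : inI (\sum_t G t *: ep (bpath len t)).
  apply: (lam_inI tH) => t gt; rewrite GE -scaleN1r lamD lamZ.
  suff -> : lam t (\sum_(t | good t) lam t f *: ep (bpath len t)) = lam t f.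
    by rewrite mulN1r subrr.
  rewrite lam_sum (bigD1 t) //= big1 => [|t' /andP[gt' nt]].
    by case/andP: (gt) => _ pt; rewrite lamZ (lam_bpath tH) // eqxx mulr1 addr0.
  by case/andP: gt' => _ pt; rewrite lamZ (lam_bpath tH) // eq_sym (negPf nt) mulr0.
rewrite GE -scaleN1r DdD DdZ lamD lamZ mulN1r => /eqP; rewrite subr_eq0 => /eqP ->.
by rewrite Dd_sum lam_sum; apply: eq_bigr => t _; rewrite DdZ Dd_ep lamZ mulrC.
Qed.

(** A good branch of length at least 2 is sent to a multiple of itself and contributes to its own
    row only; the Z-arrows account for the matrix product. *)
Lemma lam_Dd_zarr d d' s u : isDer d -> parallel d' -> good s ->
  lam s (Dd d (d' (zarr u))) = \sum_v Lam s v d * Lam (zbr v) u d' +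
    (if (1 < len s)%N then bsum s d * Lam s u d' else 0).
Proof.
move=> hd pd' gs; have pd := hd.1.
rewrite {1}(zarr_span tH u pd') lam_Dd // -(zarr_span tH u pd') sum_good.
congr (_ + _); first by apply: eq_bigr => v _; rewrite (Dpath_zbr tH).
have nZE t : nZ t -> lam s (Dpath d (bpath len t)) = bsum t d * (s == t)%:R.
  case/and3P => l1 _ pt; rewrite (Dpath_bpath (branch_gt0 tH)) // lamZ.
  by rewrite (lam_bpath tH).
case: ifP => l1; last first.
  apply: big1 => t nt; rewrite nZE //; case: eqP => [e|_]; last by rewrite mulr0 mul0r.
  by case/and3P: nt; rewrite -e l1.
have ns : nZ s by case/andP: gs => ms ps; rewrite /B0w_nZ l1 ms.
rewrite (bigD1 s) //= big1 => [|t /andP[nt ne]]; last first.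
  by rewrite nZE // eq_sym (negPf ne) mulr0 mul0r.
by rewrite nZE // eqxx mulr1 addr0.
Qed.

Lemma Lam_br d d' s u : isDer d -> isDer d' -> good s ->
  Lam s u (br d d') =
    \sum_v (Lam s v d * Lam (zbr v) u d' - Lam s v d' * Lam (zbr v) u d) +
    (if (1 < len s)%N then bsum s d * Lam s u d' - bsum s d' * Lam s u d else 0).
Proof.
move=> hd hd' gs; rewrite LamE ffunE -scaleN1r lamD lamZ mulN1r.
rewrite (lam_Dd_zarr u hd hd'.1 gs) (lam_Dd_zarr u hd' hd.1 gs) sumrB opprD addrACA.
by congr (_ + _); case: ifP => //; rewrite subr0.
Qed.

(** A parallel map rescales every path through a monomial relation, and Z-arrows occur in no
    relation; it remains to make each rho_r an eigenvector. *)
Lemma isDer_crit d : parallel d ->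
  (forall r s, B r s != 0 -> bsum s d = bsum (kp r) d) -> isDer d.
Proof.
have l0 := branch_gt0 tH; move=> pd hB; split=> // f.
elim/(inI_ind tH) => [|g h gP hP|c g gP|r j k hj hk|r].
- by rewrite Dd0; apply: inI0.
- by rewrite DdD; apply: inID.
- by rewrite DdZ; apply: inIZ.
- have hb := mono_bounds tH r; rewrite Dd_ep (Dpath_parallel l0) //; [|lia..].
  by apply: inIZ; apply: (inI_mono tH).
have -> : Dd d (rho len B r) = bsum (kp r) d *: rho len B r; last first.
  by apply/inIZ/(inI_rho tH).
rewrite Dd_sum scaler_sumr; apply: eq_bigr => s _; rewrite DdZ Dd_ep.
case: (eqVneq (B r s) 0) => [->|Bn]; first by rewrite !scale0r scaler0.
have /andP[l1 _] := B_support tH Bn.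
by rewrite (Dpath_bpath l0 pd l1) (hB r s Bn) !scalerA mulrC.
Qed.

(** The element d(rho_r) - S_(kp r) rho_r lies in I and has no pivot terms, so its coordinate at a
    non-pivot s is B r s (S_s - S_(kp r)), which must vanish. *)
Lemma bsum_rel d r s : isDer d -> B r s != 0 -> bsum s d = bsum (kp r) d.
Proof.
have l0 := branch_gt0 tH; move=> [pd hd] Bn.
case: (eqVneq s (kp r)) => [->//|ns].
have /andP[l1 ms] := B_support tH Bn.
have ps : ~~ is_pivot kp s.
  apply/is_pivotP => -[r' e]; case: (eqVneq r r') => [er|nr].
    by rewrite e er eqxx in ns.
  by rewrite e (B_pivot_other tH) ?eqxx // eq_sym in Bn.
have gs : good s by rewrite /good ms.
pose F t := B r t * (bsum t d - bsum (kp r) d).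
have FE : \sum_t F t *: ep (bpath len t) = Dd d (rho len B r) + (- bsum (kp r) d) *: rho len B r.
  rewrite Dd_sum scaler_sumr -big_split; apply: eq_bigr => t _ /=.
  rewrite DdZ Dd_ep /F; case: (eqVneq (B r t) 0) => [->|Bt].
    by rewrite mul0r !scale0r scaler0 addr0.
  have /andP[lt _] := B_support tH Bt.
  by rewrite (Dpath_bpath l0 pd lt) !scalerA -scalerDl mulrBr mulNr [bsum (kp r) d * _]mulrC.
have : lam s (\sum_t F t *: ep (bpath len t)) = 0.
  apply: (inI_lam tH gs); rewrite FE; apply: inID; first exact/hd/(inI_rho tH).
  exact/inIZ/(inI_rho tH).
rewrite lamE (sum_bpathE tH) big1 => [|r' _].
  by move/eqP; rewrite subr0 mulf_eq0 (negPf Bn) subr_eq0 => /eqP.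
rewrite (sum_bpathE tH) /F; case: (eqVneq r' r) => [->|nr].
  by rewrite subrr !mulr0.
by rewrite (B_pivot_other tH) // mul0r mulr0.
Qed.

Lemma bsum_connect d i j : isDer d -> connect (Qedge mono B) i j -> bsum i d = bsum j d.
Proof.
move=> hd /connectP[p]; elim: p i => [i _ ->//|k p IH i] /= /andP[/and3P[_ _ eik] hp] hj.
rewrite -(IH k) //; case/existsP: eik => r /andP[Bi Bk].
by rewrite (bsum_rel hd Bi) (bsum_rel hd Bk).
Qed.

End Derivations.

(** * Spans and generators *)

Section Span.
Variables (N : nat) (len : 'I_N -> nat).
Implicit Types (P Q : DerD len -> Prop) (d e : DerD len).

Lemma inspan_ind P Q : Q 0 -> (forall c d e, Q d -> Q e -> Q (c *: d + e)) ->
  (forall d, P d -> Q d) -> forall d, inspan P d -> Q d.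
Proof.
move=> Q0 Ql PQ d [n [c [v [hv ->]]]].
by elim/big_rec: _ => // k e _; apply/Ql/PQ/hv.
Qed.

Lemma inspan0 P : inspan P 0.
Proof.
exists 0%N, (fun=> 0), (fun=> 0); split; last by rewrite big_ord0.
by case.
Qed.

Lemma inspanD P d e : inspan P d -> inspan P e -> inspan P (d + e).
Proof.
move=> [n [c [v [hv ->]]]] [n' [c' [v' [hv' ->]]]].
exists (n + n')%N, (fun k => match split k with inl i => c i | inr i => c' i end),
  (fun k => match split k with inl i => v i | inr i => v' i end); split.
  by move=> k; case: (split k).
rewrite big_split_ord; congr (_ + _); apply: eq_bigr => k _.
  by rewrite (unsplitK (inl k)).
by rewrite (unsplitK (inr k)).
Qed.

Lemma inspan_gen P c d : P d -> inspan P (c *: d).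
Proof. by move=> Pd; exists 1%N, (fun=> c), (fun=> d); split=> //; rewrite big_ord1. Qed.

Lemma inspan1 P d : P d -> inspan P d.
Proof. by move=> /(inspan_gen 1); rewrite scale1r. Qed.

Lemma inspan_sum P (I : finType) (R : pred I) (F : I -> DerD len) :
  (forall i, R i -> inspan P (F i)) -> inspan P (\sum_(i | R i) F i).
Proof. by move=> h; elim/big_ind: _ => //; [exact: inspan0|exact: inspanD]. Qed.

Lemma inspanS P Q d : (forall e, P e -> Q e) -> inspan P d -> inspan Q d.
Proof. by move=> PQ [n [c [v [hv ->]]]]; exists n, c, v; split=> // k; apply/PQ/hv. Qed.

End Span.

(** [C] is declared as a bare field, so characteristic 0 is taken from the numeric structure of the
    complex numbers underneath. *)
Lemma natC_neq0 n : n.+1%:R != 0 :> C.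
Proof. exact: (negbT (@Num.Theory.pnatr_eq0 (Rdefinitions.R[i])%C n.+1)). Qed.

(** * Coordinates of the generators *)

Section Generators.
Variables (N : nat) (len : 'I_N -> nat).
Variables (nm : nat) (mono : 'I_nm -> 'I_N * 'I_(K len).+1 * 'I_(K len).+1).
Variables (nn : nat) (B : 'M[C]_(nn, N)) (kp : 'I_nn -> 'I_N) (a : nat).
Hypothesis tH : toupie_hyp mono B kp a.

Local Notation lam := (@lam N len nn B kp).
Local Notation good := (good mono kp).
Local Notation zbr := (zbr tH).
Local Notation zarr := (zarr tH).
Local Notation Lam := (Lam tH).
Local Notation nZ := (B0w_nZ mono kp).
Local Notation isDer := (isDer mono B).
Local Notation hasmono := (hasmono mono).
Local Notation hheq := (hheq mono B).
Implicit Types (d e : DerD len).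

Lemma hheqP d e : parallel d -> parallel e -> hheq d e <->
  exists k : C, (forall i, (1 < len i)%N -> bsum i d = bsum i e + k) /\
    (forall s u, good s -> Lam s u d = Lam s u e + k * (s == zbr u)%:R).
Proof.
move=> pd pe; have pde : parallel (d - e) by apply/parallelD/parallelN.
split=> [/hheq_sub/(hheq0P tH pde)|] [k [h1 h2]].
  exists k; split=> [i l1|s u gs].
    by rewrite -(h1 i l1) -bsumD addrC subrK.
  by rewrite -h2 // -LamD addrC subrK.
apply/hheq_sub/(hheq0P tH pde); exists k; split=> [i l1|s u gs].
  by rewrite -scaleN1r bsumD bsumZ h1 // mulN1r addrAC subrr add0r.
by rewrite -scaleN1r LamD LamZ h2 // mulN1r addrAC subrr add0r.
Qed.

Lemma hheq_coord d e : parallel d -> parallel e ->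
  (forall i, (1 < len i)%N -> bsum i d = bsum i e) ->
  (forall s u, good s -> Lam s u d = Lam s u e) -> hheq d e.
Proof.
move=> pd pe h1 h2; apply/hheqP => //; exists 0; split=> [i l1|s u gs].
  by rewrite addr0 h1.
by rewrite mul0r addr0 h2.
Qed.

Lemma good_cases s : good s -> nZ s \/ exists v, s = zbr v.
Proof.
by case/andP=> ms ps; case: (branchP tH s) => [l1|]; [left; rewrite /B0w_nZ l1 ms|right].
Qed.

Lemma nZ_good s : nZ s -> good s.
Proof. by case/and3P => _ ms ps; rewrite goodE ms. Qed.

Lemma nZ_len s : nZ s -> (1 < len s)%N.
Proof. by case/and3P. Qed.

Lemma hasmono_len i : hasmono i -> (1 < len i)%N.
Proof. by case/existsP => r /eqP <-; have := mono_bounds tH r; lia. Qed.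

Lemma bsum0 i : bsum i (0 : DerD len) = 0.
Proof. by apply: big1 => g _; rewrite /diag !ffunE. Qed.

Lemma Lam0 s u : Lam s u 0 = 0.
Proof. by rewrite LamE ffunE lam0. Qed.

Lemma bsum_sum i (I : finType) (P : pred I) (F : I -> DerD len) :
  bsum i (\sum_(j | P j) F j) = \sum_(j | P j) bsum i (F j).
Proof. exact: (big_morph (bsum i) (bsumD i) (bsum0 i)). Qed.

Lemma Lam_sum s u (I : finType) (P : pred I) (F : I -> DerD len) :
  Lam s u (\sum_(j | P j) F j) = \sum_(j | P j) Lam s u (F j).
Proof. exact: (big_morph (Lam s u) (LamD tH s u) (Lam0 s u)). Qed.

Lemma isDer0 : isDer 0.
Proof. by apply: (isDer_crit tH) => [|r s _]; [exact: parallel0|rewrite !bsum0]. Qed.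

(** Among parallel maps, being a derivation of A is a condition on the S_i that is linear in d. *)
Lemma isDer_lin c d e : isDer d -> isDer e -> isDer (c *: d + e).
Proof.
move=> hd he; apply: (isDer_crit tH) => [|r s Bn].
  by apply: parallelD; [apply: parallelZ; case: hd|case: he].
by rewrite !bsumD !bsumZ (bsum_rel tH hd Bn) (bsum_rel tH he Bn).
Qed.

Lemma first_arrowsE (P : pred 'I_N) :
  first_arrows len P = [ffun g : arrow len => (P (abr g) && (apos g == 0%N))%:R *: ep (apath g)].
Proof.
apply/ffunP => g; rewrite !ffunE /abr /apos.
by case: (_ && _); rewrite ?scale1r ?scale0r.
Qed.

Lemma parallel_first (P : pred 'I_N) : parallel (first_arrows len P : DerD len).
Proof. rewrite first_arrowsE; exact: parallel_ffun_scale. Qed.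

Lemma bsum_first (P : pred 'I_N) i : bsum i (first_arrows len P : DerD len) = (P i)%:R.
Proof.
rewrite /bsum (eq_bigr (fun g => (P i && (apos g == 0%N))%:R)) => [|g /eqP <-]; last first.
  by rewrite /diag first_arrowsE !ffunE eqxx [LHS]mulr1.
rewrite (sum_branch len i (fun t => (P i && (t == 0%N))%:R)) big_ltn ?(branch_gt0 tH) //.
rewrite andbT big_nat big1 ?addr0 // => t /andP[t0 _].
by rewrite eqn0Ngt t0 andbF.
Qed.

Lemma Lam_first (P : pred 'I_N) s u : ~~ P (zbr u) -> Lam s u (first_arrows len P) = 0.
Proof.
move=> nP; rewrite LamE first_arrowsE ffunE abr_zarr (negPf nP) scale0r.
exact: lam0.
Qed.

(** No relation involves an arrow of Z, so all values in e_0 CQ e_omega are allowed there. *)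
Lemma isDer_Z d : (forall g, (1 < len (abr g))%N -> d g = 0) ->
  (forall u, in_e0we (d (zarr u))) ->
  isDer d /\ (forall i, (1 < len i)%N -> bsum i d = 0).
Proof.
move=> h0 h1; have b0 i : (1 < len i)%N -> bsum i d = 0.
  by move=> l1; apply: big1 => g /eqP gi; rewrite /diag h0 ?gi // ffunE.
split=> //; apply: (isDer_crit tH) => [g p|r s Bn].
  case: (arrowP tH g) => [l1|[u ->]]; first by rewrite h0 // ffunE eqxx.
  by rewrite apath_zarr (src_bpath tH) (tgt_bpath tH); apply: h1.
have /andP[ls _] := B_support tH Bn.
have /andP[lk _] : (1 < len (kp r))%N && ~~ hasmono (kp r).
  by apply: (B_support tH (r := r)); rewrite (B_pivot tH) oner_neq0.
by rewrite !b0.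
Qed.

Lemma zarr_eq (v u : 'I_a) : ((val (zarr v)).1 == u :> nat) = (v == u).
Proof. by rewrite -[RHS]val_eqE. Qed.

Lemma zarr_eq0 (v : 'I_a) : ((val (zarr v)).1 == 0%N :> nat) = (v == 0%N :> nat).
Proof. by []. Qed.

Lemma zgen_zarr (v u : 'I_a) s : zgen len u s (zarr v) = (v == u)%:R *: ep (bpath len s).
Proof.
rewrite ffunE zarr_eq.
by case: eqP => _; rewrite ?scale1r ?scale0r.
Qed.

Lemma nonZ_neq (g : arrow len) (u : nat) :
  (u < a)%N -> (1 < len (abr g))%N -> ((val g).1 == u :> nat) = false.
Proof. by move=> ua; rewrite (branch_gt1 tH) /abr => h; apply/eqP; lia. Qed.

Lemma in_e0we0 : in_e0we (0 : CQ len).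
Proof. by move=> p; rewrite ffunE eqxx. Qed.

Lemma in_e0weZ c (f : CQ len) : in_e0we f -> in_e0we (c *: f).
Proof. by move=> h; rewrite -[_ *: _]addr0; apply: in_e0we_lin => //; apply: in_e0we0. Qed.

Lemma zgen_coord (u : 'I_a) s : isDer (zgen len u s) /\
  (forall i, (1 < len i)%N -> bsum i (zgen len u s) = 0).
Proof.
apply: isDer_Z => [g l1|v]; first by rewrite ffunE nonZ_neq.
by rewrite zgen_zarr; apply/in_e0weZ/(in_e0we_ep tH).
Qed.

Lemma Lam_zgen (u v : 'I_a) s t : nZ s -> Lam t v (zgen len u s) = (v == u)%:R * (t == s)%:R.
Proof. by case/and3P => _ _ ps; rewrite LamE zgen_zarr lamZ (lam_bpath tH). Qed.

Lemma bpath_natE (u : 'I_a) : bpath_nat len u = bpath len (zbr u).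
Proof.
rewrite /bpath_nat; case: insubP => [i _ /= ei|]; last by rewrite (leq_trans _ (a_leN tH)).
by congr bpath; apply: val_inj.
Qed.

Lemma wgen_zarr (v p q : 'I_a) : wgen len p q (zarr v) = (v == p)%:R *: ep (bpath len (zbr q)).
Proof.
rewrite ffunE bpath_natE zarr_eq.
by case: eqP => _; rewrite ?scale1r ?scale0r.
Qed.

Lemma wgen_coord (p q : 'I_a) : isDer (wgen len p q) /\
  (forall i, (1 < len i)%N -> bsum i (wgen len p q) = 0).
Proof.
apply: isDer_Z => [g l1|v]; first by rewrite ffunE nonZ_neq.
by rewrite wgen_zarr; apply/in_e0weZ/(in_e0we_ep tH).
Qed.

Lemma Lam_wgen (p q v : 'I_a) t : Lam t v (wgen len p q) = (v == p)%:R * (t == zbr q)%:R.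
Proof.
have /andP[_ pq] := good_zbr tH q.
by rewrite LamE wgen_zarr lamZ (lam_bpath tH).
Qed.

Lemma xgen_zarr (v j : 'I_a) : j != 0%N :> nat ->
  xgen len j (zarr v) = ((v == j)%:R - (v == 0%N :> nat)%:R) *: ep (bpath len (zbr v)).
Proof.
move=> j0; rewrite ffunE zarr_eq zarr_eq0 (apath_zarr tH).
case: eqP => [->|_]; first by rewrite (negPf j0) subr0 scale1r.
by case: eqP => _; rewrite ?subrr ?scale0r // sub0r scaleN1r.
Qed.

Lemma xgen_coord (j : 'I_a) : j != 0%N :> nat -> isDer (xgen len j) /\
  (forall i, (1 < len i)%N -> bsum i (xgen len j) = 0).
Proof.
move=> j0; apply: isDer_Z => [g l1|v]; first by rewrite ffunE !nonZ_neq // (a_gt0 tH).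
by rewrite xgen_zarr //; apply/in_e0weZ/(in_e0we_ep tH).
Qed.

Lemma Lam_xgen (j v : 'I_a) t : j != 0%N :> nat ->
  Lam t v (xgen len j) = ((v == j)%:R - (v == 0%N :> nat)%:R) * (t == zbr v)%:R.
Proof.
move=> j0; have /andP[_ pv] := good_zbr tH v.
by rewrite LamE xgen_zarr // lamZ (lam_bpath tH).
Qed.

Lemma zbr_Qv u : Qv mono (zbr u) = false.
Proof. by rewrite /Qv (zbr_len tH). Qed.

Lemma zbr_mono u : hasmono (zbr u) = false.
Proof. by apply/negbTE/negP => /hasmono_len; rewrite (zbr_len tH). Qed.

(** A branch with a monomial relation occurs in no rho_r, so the S-values to be compared are both
    0. *)
Lemma isDer_ygen i : hasmono i -> isDer (ygen len i).
Proof.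
move=> mi; apply: (isDer_crit tH) => [|r s Bn]; first exact: parallel_first.
rewrite !bsum_first; congr (_%:R); congr nat_of_bool; rewrite /=.
have /andP[_ ms] := B_support tH Bn.
have -> : (s == i) = false by apply/eqP => e; rewrite e mi in ms.
by apply/esym/eqP => e; rewrite -e (hasmono_pivot tH) in mi.
Qed.

(** The branches of one rho_r are joined by edges of Q_rho, hence lie in the same component. *)
Lemma isDer_tgen i : isDer (tgen mono B i).
Proof.
apply: (isDer_crit tH) => [|r s Bn]; first exact: parallel_first.
rewrite !bsum_first; congr (_%:R); congr nat_of_bool; rewrite /=.
have /(B_support tH) Qk : B r (kp r) != 0 by rewrite (B_pivot tH) oner_neq0.
have Qs := B_support tH Bn; rewrite /Qv Qk Qs /=.
have e1 x y : B r x != 0 -> B r y != 0 -> connect (Qedge mono B) x y.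
  move=> Bx By; apply: connect1; rewrite /Qedge /Qv (B_support tH Bx) (B_support tH By).
  by apply/existsP; exists r; rewrite Bx By.
have Bk : B r (kp r) != 0 by rewrite (B_pivot tH) oner_neq0.
by apply/idP/idP => h; apply: connect_trans h _; apply: e1.
Qed.

Lemma isDer_span (P : DerD len -> Prop) d : (forall e, P e -> isDer e) ->
  inspan P d -> isDer d.
Proof. move=> h; exact: (inspan_ind isDer0 isDer_lin h). Qed.

End Generators.
Arguments hheq_coord {N len nm mono nn B kp a} tH {d e}.

(** * The ideals L and L_2 *)

Section Structure.
Variables (N : nat) (len : 'I_N -> nat).
Variables (nm : nat) (mono : 'I_nm -> 'I_N * 'I_(K len).+1 * 'I_(K len).+1).
Variables (nn : nat) (B : 'M[C]_(nn, N)) (kp : 'I_nn -> 'I_N) (a : nat).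
Hypothesis tH : toupie_hyp mono B kp a.

Local Notation good := (good mono kp).
Local Notation zbr := (zbr tH).
Local Notation Lam := (Lam tH).
Local Notation nZ := (B0w_nZ mono kp).
Local Notation isDer := (isDer mono B).
Local Notation hasmono := (hasmono mono).
Local Notation hheq := (hheq mono B).
Local Notation inSub := (inSub mono B).
Local Notation C1 := (Ygen mono).
Local Notation S1 := (Tgen mono B).
Local Notation L2 := (Zgen mono kp a).
Local Notation L := (Lgen mono B kp a).
Local Notation M := (@Mgen N len a).
Implicit Types (d e x y l m : DerD len).

Lemma hheq_trans d e l : parallel d -> parallel e -> parallel l ->
  hheq d e -> hheq e l -> hheq d l.
Proof.
move=> pd pe pl /(hheqP tH pd pe)[k [h1 h2]] /(hheqP tH pe pl)[k' [h1' h2']].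
apply/(hheqP tH pd pl); exists (k + k'); split=> [i l1|s u gs].
  by rewrite h1 // h1' // -addrA [k' + k]addrC.
by rewrite h2 // h2' // -addrA mulrDl [X in _ + X]addrC.
Qed.

Lemma inSubS (P Q : DerD len -> Prop) d : (forall e, P e -> Q e) -> inSub P d -> inSub Q d.
Proof. by move=> PQ [e [he hde]]; exists e; split=> //; apply: inspanS he. Qed.

Lemma inSub_hheq0 (P : DerD len -> Prop) d : hheq d 0 -> inSub P d.
Proof. by move=> h; exists 0; split=> //; apply: inspan0. Qed.

Lemma zgenP d : L2 d -> exists (u : 'I_a) s, nZ s /\ d = zgen len u s.
Proof. by case=> u [s [ua ns ->]]; exists (Ordinal ua), s. Qed.

Lemma mgenP d : M d ->
  (exists2 j : 'I_a, j != 0%N :> nat & d = xgen len j) \/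
  (exists p q : 'I_a, p != q /\ d = wgen len p q).
Proof.
case=> [[j [/andP[j0 ja] ->]]|[p [q [pa qa pq ->]]]].
  by left; exists (Ordinal ja); rewrite //= -lt0n.
by right; exists (Ordinal pa), (Ordinal qa).
Qed.

Lemma Y_coord y : inspan C1 y -> [/\ isDer y,
  forall i, ~~ hasmono i -> bsum i y = 0 & forall s u, Lam s u y = 0].
Proof.
elim/inspan_ind => {y} [|c d e [h1 h2 h3] [k1 k2 k3]|d [i [mi ->]]]; split.
- exact: (isDer0 tH).
- by move=> i _; rewrite bsum0.
- by move=> s u; rewrite Lam0.
- exact: (isDer_lin tH).
- by move=> i ni; rewrite bsumD bsumZ h2 // k2 // mulr0 addr0.
- by move=> s u; rewrite LamD LamZ h3 k3 mulr0 addr0.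
- exact: (isDer_ygen tH).
- move=> j nj; rewrite (bsum_first tH) /=; case: eqP => // ej.
  by rewrite ej mi in nj.
by move=> s u; apply: Lam_first; apply/eqP => e; have := zbr_mono tH u; rewrite e mi.
Qed.

Lemma T_coord d : inspan S1 d -> [/\ isDer d,
  forall i, hasmono i -> bsum i d = 0 & forall s u, Lam s u d = 0].
Proof.
elim/inspan_ind => {d} [|c d e [h1 h2 h3] [k1 k2 k3]|d [i [qi ->]]]; split.
- exact: (isDer0 tH).
- by move=> i _; rewrite bsum0.
- by move=> s u; rewrite Lam0.
- exact: (isDer_lin tH).
- by move=> i ni; rewrite bsumD bsumZ h2 // k2 // mulr0 addr0.
- by move=> s u; rewrite LamD LamZ h3 k3 mulr0 addr0.
- exact: (isDer_tgen tH).
- by move=> j nj; rewrite (bsum_first tH) /= /Qv nj andbF.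
by move=> s u; apply: Lam_first; rewrite (zbr_Qv tH).
Qed.

Lemma Z_coord d : inspan L2 d -> [/\ isDer d,
  forall i, (1 < len i)%N -> bsum i d = 0 & forall v u, Lam (zbr v) u d = 0].
Proof.
elim/inspan_ind => {d} [|c d e [h1 h2 h3] [k1 k2 k3]|d /zgenP[u [s [ns ->]]]]; split.
- exact: (isDer0 tH).
- by move=> i _; rewrite bsum0.
- by move=> s u; rewrite Lam0.
- exact: (isDer_lin tH).
- by move=> i ni; rewrite bsumD bsumZ h2 // k2 // mulr0 addr0.
- by move=> s u; rewrite LamD LamZ h3 k3 mulr0 addr0.
- by have [] := zgen_coord tH u s.
- by have [] := zgen_coord tH u s.
move=> v w; rewrite Lam_zgen //; case: (eqVneq (zbr v) s) => [e|]; last by rewrite mulr0.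
by have := nZ_len ns; rewrite -e (zbr_len tH).
Qed.

Lemma L_coord d : inspan L d -> [/\ isDer d,
  forall i, hasmono i -> bsum i d = 0 & forall v u, Lam (zbr v) u d = 0].
Proof.
elim/inspan_ind => {d} [|c d e [h1 h2 h3] [k1 k2 k3]|d]; [split|split|].
- exact: (isDer0 tH).
- by move=> i _; rewrite bsum0.
- by move=> s u; rewrite Lam0.
- exact: (isDer_lin tH).
- by move=> i ni; rewrite bsumD bsumZ h2 // k2 // mulr0 addr0.
- by move=> s u; rewrite LamD LamZ h3 k3 mulr0 addr0.
case=> [/inspan1/T_coord[h1 h2 h3]|/inspan1/Z_coord[h1 h2 h3]]; split=> // i mi.
by rewrite h2 // (hasmono_len tH).
Qed.

Lemma sum_delta (F : 'I_a -> C) u : \sum_w F w * (w == u)%:R = F u.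
Proof.
rewrite (bigD1 u) //= eqxx mulr1 big1 ?addr0 // => w nw.
by rewrite (negPf nw) mulr0.
Qed.

Lemma nZ_neq s u : nZ s -> (s == zbr u) = false.
Proof. by move=> ns; apply/eqP => e; have := nZ_len ns; rewrite e (zbr_len tH). Qed.

Lemma M_coord d : inspan M d -> [/\ isDer d,
  forall i, (1 < len i)%N -> bsum i d = 0,
  forall s u, nZ s -> Lam s u d = 0 & \sum_u Lam (zbr u) u d = 0].
Proof.
elim/inspan_ind => {d} [|c d e [h1 h2 h3 h4] [k1 k2 k3 k4]|d].
- split; first exact: (isDer0 tH).
  + by move=> i _; rewrite bsum0.
  + by move=> s u _; rewrite Lam0.
  by apply: big1 => u _; rewrite Lam0.
- split; first exact: (isDer_lin tH).
  + by move=> i ni; rewrite bsumD bsumZ h2 // k2 // mulr0 addr0.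
  + by move=> s u ns; rewrite LamD LamZ h3 // k3 // mulr0 addr0.
  rewrite (eq_bigr (fun u => c * Lam (zbr u) u d + Lam (zbr u) u e)) => [|u _].
    by rewrite big_split /= -mulr_sumr h4 k4 mulr0 addr0.
  by rewrite LamD LamZ.
case/mgenP => [[j j0 ->]|[p [q [pq ->]]]].
  have [h1 h2] := xgen_coord tH j0; split=> //.
    by move=> s u ns; rewrite Lam_xgen // nZ_neq // mulr0.
  (* The trace of E_jj - E_11, with explicit factors 1 so that [sum_delta] applies; index 0 stands
     for alpha^(1). *)
  rewrite (eq_bigr (fun u : 'I_a => 1 * (u == j)%:R - 1 * (u == Ordinal (a_gt0 tH))%:R)) => [|u _].
    by rewrite sumrB !(sum_delta (fun=> 1)) subrr.
  by rewrite Lam_xgen // eqxx mulr1 !mul1r.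
have [h1 h2] := wgen_coord tH p q; split=> //.
  by move=> s u ns; rewrite Lam_wgen nZ_neq // mulr0.
apply: big1 => u _; rewrite Lam_wgen (inj_eq (zbr_inj tH)).
by case: eqP => [->|]; rewrite ?mul0r // (negPf pq) mulr0.
Qed.

Lemma gen_isDer d : C1 d \/ M d \/ L d -> isDer d.
Proof.
case=> [|[]] /inspan1.
- by case/Y_coord.
- by case/M_coord.
by case/L_coord.
Qed.

(** L_2 realises every prescribed block below the Z-block. *)
Lemma zcomb_coord (F : 'I_N -> 'I_a -> C) :
  let d := \sum_u \sum_(s | nZ s) F s u *: zgen len u s in
  inspan L2 d /\ forall s u, nZ s -> Lam s u d = F s u.
Proof.
split=> [|s u ns].
  apply: inspan_sum => u _; apply: inspan_sum => s ns; apply: inspan_gen.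
  by exists u, s; split.
rewrite Lam_sum (bigD1 u) //= [X in _ + X]big1 ?addr0 => [|v nv]; last first.
  rewrite Lam_sum big1 // => t nt.
  by rewrite LamZ Lam_zgen // eq_sym (negPf nv) mul0r mulr0.
rewrite Lam_sum (bigD1 s) //= [X in _ + X]big1 ?addr0 => [|t /andP[nt ne]].
  by rewrite LamZ Lam_zgen // !eqxx !mulr1.
by rewrite LamZ Lam_zgen // [s == t]eq_sym (negPf ne) !mulr0.
Qed.

Lemma inSub_L2 d : parallel d -> (forall i, (1 < len i)%N -> bsum i d = 0) ->
  (forall v u, Lam (zbr v) u d = 0) -> inSub L2 d.
Proof.
move=> pd h1 h2; have [hz hL] := zcomb_coord (fun s u => Lam s u d).
set z := \sum_u _ in hz hL; have [dz bz Zz] := Z_coord hz.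
exists z; split=> //; apply: (hheq_coord tH) => //; first by case: dz.
  by move=> i l1; rewrite h1 ?bz.
by move=> s u /(good_cases tH)[ns|[v ->]]; [rewrite hL|rewrite h2 Zz].
Qed.

(** The Z-block of the bracket is a commutator with 0. This one fact makes both L and L_2 ideals. *)
Lemma br_L2 d l : isDer d -> isDer l -> (forall v u, Lam (zbr v) u l = 0) ->
  inSub L2 (br d l).
Proof.
move=> hd hl h; apply: inSub_L2.
- by apply: (parallel_br tH); [case: hd|case: hl].
- by move=> i l1; apply: (bsum_br tH) => //; [case: hd|case: hl].
move=> v u; rewrite Lam_br ?(good_zbr tH) // (zbr_len tH) addr0.
by apply: big1 => w _; rewrite !h mulr0 mul0r subrr.
Qed.

Lemma L2_ideal : is_ideal mono B L2.
Proof. by move=> d l hd /Z_coord[hl _ h]; apply: br_L2. Qed.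

Lemma L_ideal : is_ideal mono B L.
Proof.
move=> d l hd /L_coord[hl _ h]; apply: (@inSubS L2); last exact: br_L2.
by move=> e; right.
Qed.

Lemma S1_abelian : is_abelian mono B S1.
Proof.
move=> l l' /T_coord[hl _ h] /T_coord[hl' _ h'].
have [pl pl'] := (hl.1, hl'.1).
apply: (hheq_coord tH); [exact: (parallel_br tH)|exact: parallel0|..].
  by move=> i l1; rewrite (bsum_br tH) // bsum0.
move=> s u gs; rewrite Lam_br // Lam0 big1 => [|w _]; last by rewrite !h !h' !mul0r subrr.
by case: ifP; rewrite ?h ?h' ?mulr0 ?subrr add0r.
Qed.

Lemma L2_abelian : is_abelian mono B L2.
Proof.
move=> l l' /Z_coord[hl b h] /Z_coord[hl' b' h'].
have [pl pl'] := (hl.1, hl'.1).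
apply: (hheq_coord tH); [exact: (parallel_br tH)|exact: parallel0|..].
  by move=> i l1; rewrite (bsum_br tH) // bsum0.
move=> s u gs; rewrite Lam_br // Lam0 big1 => [|w _]; last by rewrite h h' !mulr0 subrr.
by case: ifP => l1; rewrite ?b ?b' ?mul0r ?subrr ?add0r.
Qed.

Lemma abelian_subalgebra (P : DerD len -> Prop) : is_abelian mono B P -> is_subalgebra mono B P.
Proof. by move=> h l l' hl hl'; apply/inSub_hheq0/h. Qed.

(** Both Z-blocks are zero, so a diagonal entry, available because a > 0, forces k = 0; the S_i of s
    are then those of l, which vanish. *)
Lemma S1_L2_disjoint s l : inspan S1 s -> inspan L2 l -> hheq s l -> hheq s 0.
Proof.
move=> /T_coord[hs _ h] /Z_coord[hl b h'].
have [ps pl] := (hs.1, hl.1).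
case/(hheqP tH ps pl) => k [h1 h2]; pose u0 := Ordinal (a_gt0 tH).
have := h2 _ u0 (good_zbr tH u0); rewrite h h' add0r eqxx mulr1 => k0.
apply: (hheq_coord tH) => //; first exact: parallel0.
  by move=> i l1; rewrite h1 // b // -k0 addr0 bsum0.
by move=> t u gt; rewrite h Lam0.
Qed.

(** The shape taken by the Z-block of an element of L once an inner derivation is added. *)
Definition Zscalar (k : C) d := forall v u, Lam (zbr v) u d = k * (v == u)%:R.

Lemma Lam_br_zbr d e v u : isDer d -> isDer e -> Lam (zbr v) u (br d e) =
  \sum_w (Lam (zbr v) w d * Lam (zbr w) u e - Lam (zbr v) w e * Lam (zbr w) u d).
Proof. by move=> hd he; rewrite Lam_br ?(good_zbr tH) // (zbr_len tH) addr0. Qed.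

Lemma Lam_br_scalar k k' x y v u : isDer x -> isDer y -> Zscalar k x -> Zscalar k' y ->
  Lam (zbr v) u (br x y) = 0.
Proof.
move=> hx hy sx sy; rewrite Lam_br_zbr //.
by apply: big1 => w _; rewrite !sx !sy mulrACA [X in _ - X]mulrACA [k' * k]mulrC subrr.
Qed.

(** Scalar Z-blocks commute, so up to inner derivations a first bracket has no S_i and no Z-block
    left; a second bracket then vanishes entirely. *)
Lemma L_solvable : is_solvable mono B L.
Proof.
have d0 d : derived mono B L 0 d -> isDer d /\ exists k, Zscalar k d.
  move=> [hd [e [/L_coord[he _ h]]]]; have [pd pe] := (hd.1, he.1).
  case/(hheqP tH pd pe) => k [_ h2]; split=> //; exists k => v u.
  by rewrite h2 ?(good_zbr tH) // h add0r (inj_eq (zbr_inj tH)).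
(* Passes a property from brackets to their span; [parallel] goes along because equality in HH^1 is
   decoded only for parallel maps. *)
have spanbr (P Q : DerD len -> Prop) e : Q 0 ->
    (forall c d e, parallel d /\ Q d -> parallel e /\ Q e -> Q (c *: d + e)) ->
    (forall x y, P x -> P y -> parallel (br x y) /\ Q (br x y)) ->
    inspan (fun b => exists x y, [/\ P x, P y & b = br x y]) e -> parallel e /\ Q e.
  move=> Q0 Ql Qb; apply: (inspan_ind (Q := fun e => parallel e /\ Q e)).
  - by split=> //; apply: parallel0.
  - move=> c d e' hd he; split; last exact: Ql.
    by apply: parallelD; [apply: parallelZ; case: hd|case: he].
  by move=> d [x [y [Px Py ->]]]; apply: Qb.
(* The same k appears in the S_i and in the Z-block, since both come from one inner derivation. *)
have d1 d : derived mono B L 1 d -> isDer d /\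
    exists k, (forall i, (1 < len i)%N -> bsum i d = k) /\ Zscalar k d.
  move=> [hd [e [he hde]]]; split=> //.
  have [|c d' e' [_ [q1 q2]] [_ [r1 r2]]|x y /d0[hx [k sx]] /d0[hy [k' sy]]|pe [b h]] :=
    spanbr _ (fun e => (forall i, (1 < len i)%N -> bsum i e = 0) /\
                 (forall v u, Lam (zbr v) u e = 0)) e _ _ _ he.
  - by split=> *; rewrite ?bsum0 ?Lam0.
  - split=> [i l1|v u]; first by rewrite bsumD bsumZ q1 // r1 // mulr0 addr0.
    by rewrite LamD LamZ q2 r2 mulr0 addr0.
  - have [px py] := (hx.1, hy.1); split; first exact: (parallel_br tH).
    by split=> [i l1|v u]; [rewrite (bsum_br tH)|rewrite (Lam_br_scalar v u hx hy sx sy)].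
  have pd := hd.1; case/(hheqP tH pd pe): hde => k [h1 h2]; exists k; split=> [i l1|v u].
    by rewrite h1 // b // add0r.
  by rewrite h2 ?(good_zbr tH) // h add0r (inj_eq (zbr_inj tH)).
exists 2%N => d [hd [e [he hde]]].
have [|c d' e' [_ [q1 q2]] [_ [r1 r2]]|x y /d1[hx [k [bx sx]]] /d1[hy [k' [b_y sy]]]|pe [b h]] :=
  spanbr _ (fun e => (forall i, (1 < len i)%N -> bsum i e = 0) /\
               (forall s u, good s -> Lam s u e = 0)) e _ _ _ he.
- by split=> *; rewrite ?bsum0 ?Lam0.
- split=> [i l1|s u gs]; first by rewrite bsumD bsumZ q1 // r1 // mulr0 addr0.
  by rewrite LamD LamZ q2 // r2 // mulr0 addr0.
- have [px py] := (hx.1, hy.1); split; first exact: (parallel_br tH).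
  split=> [i l1|s u gs]; first by rewrite (bsum_br tH).
  case: (good_cases tH gs) => [ns|[v ->]]; last exact: (Lam_br_scalar v u hx hy sx sy).
  have l1 := nZ_len ns; rewrite Lam_br // l1 bx // b_y // sumrB.
  (* With scalar Z-blocks the matrix products give k' Lam s u x - k Lam s u y, which the terms in
     S_s cancel. *)
  rewrite (eq_bigr (fun w => Lam s w x * k' * (w == u)%:R)) => [|w _]; last by rewrite sy mulrA.
  rewrite [X in _ - X + _](eq_bigr (fun w => Lam s w y * k * (w == u)%:R)) => [|w _]; last first.
    by rewrite sx mulrA.
  rewrite (sum_delta (fun w => Lam s w x * k')) (sum_delta (fun w => Lam s w y * k)).
  by rewrite [k * _]mulrC [k' * _]mulrC addrA subrK subrr.
have pd := hd.1; apply: hheq_trans hde _ => //; first exact: parallel0.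
apply: (hheq_coord tH) => //; first exact: parallel0.
  by move=> i l1; rewrite b // bsum0.
by move=> s u gs; rewrite h // Lam0.
Qed.

End Structure.

(** * The decomposition of HH^1 *)

Section Decomposition.
Variables (N : nat) (len : 'I_N -> nat).
Variables (nm : nat) (mono : 'I_nm -> 'I_N * 'I_(K len).+1 * 'I_(K len).+1).
Variables (nn : nat) (B : 'M[C]_(nn, N)) (kp : 'I_nn -> 'I_N) (a : nat).
Hypothesis tH : toupie_hyp mono B kp a.

Local Notation good := (good mono kp).
Local Notation zbr := (zbr tH).
Local Notation Lam := (Lam tH).
Local Notation nZ := (B0w_nZ mono kp).
Local Notation isDer := (isDer mono B).
Local Notation hasmono := (hasmono mono).
Local Notation hheq := (hheq mono B).
Local Notation inSub := (inSub mono B).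
Local Notation C1 := (Ygen mono).
Local Notation S1 := (Tgen mono B).
Local Notation L2 := (Zgen mono kp a).
Local Notation L := (Lgen mono B kp a).
Local Notation M := (@Mgen N len a).
Local Notation u0 := (Ordinal (a_gt0 tH)).
Implicit Types (d e x y l m : DerD len) (dx : 'I_a -> C) (ew : 'I_a -> 'I_a -> C).

Lemma aC_neq0 : a%:R != 0 :> C.
Proof. by rewrite -(prednK (a_gt0 tH)) natC_neq0. Qed.

(** * The identification with sl_a *)

Lemma Mcomb_span dx ew : inspan M (Mcomb len dx ew).
Proof.
apply: inspanD; apply: inspan_sum.
  by move=> j j0; apply: inspan_gen; left; exists j; rewrite lt0n j0 ltn_ord.
move=> p _; apply: inspan_sum => q pq; apply: inspan_gen.
by right; exists p, q; split=> //; rewrite eq_sym.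
Qed.

Lemma offdiag (v u j : 'I_a) : v != u -> (v == j) && (u == j) = false.
Proof. by move=> nvu; apply/andP => -[/eqP ev /eqP eu]; rewrite ev eu eqxx in nvu. Qed.

Lemma offdiag0 (v u : 'I_a) : v != u -> (v == 0%N :> nat) && (u == 0%N :> nat) = false.
Proof.
move=> nvu; apply/andP => -[/eqP ev /eqP eu]; case/eqP: nvu.
by apply: val_inj; rewrite /= ev eu.
Qed.

Lemma Lam_Mcomb dx ew v u : Lam (zbr v) u (Mcomb len dx ew) = mxcomb dx ew v u.
Proof.
rewrite LamD !Lam_sum /mxcomb mxE !summxE; congr (_ + _); apply: eq_bigr => j j0.
  rewrite LamZ Lam_xgen // !mxE (inj_eq (zbr_inj tH)); congr (_ * _).
  case: (eqVneq v u) => [->|nvu]; rewrite ?andbb ?mulr1 // mulr0.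
  by rewrite offdiag // offdiag0 // subrr.
rewrite Lam_sum summxE; apply: eq_bigr => q _.
by rewrite LamZ Lam_wgen !mxE (inj_eq (zbr_inj tH)) -mulnb natrM [X in _ * X = _]mulrC.
Qed.

Lemma mxcomb_trace dx ew : \tr (mxcomb dx ew) = 0.
Proof.
have [_ _ _] := M_coord tH (Mcomb_span dx ew).
by rewrite /mxtrace => h; rewrite -[RHS]h; apply: eq_bigr => u _; rewrite Lam_Mcomb.
Qed.

(** Indices are transposed because w_pq stands for E_qp. The x_j supply all diagonal entries except
    the first, which trace zero determines. *)
Lemma mxcomb_surj (A : 'M[C]_a) : \tr A = 0 ->
  mxcomb (fun j => A j j) (fun p q => A q p) = A.
Proof.
move=> trA; apply/matrixP => v u; rewrite /mxcomb mxE !summxE.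
case: (eqVneq v u) => [<-|nvu].
  rewrite [X in _ + X]big1 ?addr0 => [|p _]; last first.
    rewrite summxE big1 // => q npq; rewrite !mxE.
    by case: eqP => [->|]; rewrite ?(negPf npq) mulr0.
  have tr0 : \sum_(j < a | j != 0%N :> nat) A j j = - A u0 u0.
    by move/eqP: trA; rewrite /mxtrace (bigD1 u0) //= addrC addr_eq0 => /eqP.
  case: (eqVneq (v : nat) 0%N) => [v0|v0].
    have -> : v = u0 by apply: val_inj.
    rewrite -[RHS]opprK -tr0 -sumrN; apply: eq_bigr => j j0.
    by rewrite !mxE /= -val_eqE /= eq_sym (negPf j0) sub0r mulrN1.
  rewrite (bigD1 v) //= big1 => [|j /andP[_ nj]].
    by rewrite !mxE !eqxx (negPf v0) subr0 mulr1 addr0.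
  by rewrite !mxE eq_sym (negPf nj) (negPf v0) subrr mulr0.
rewrite big1 ?add0r => [|j _]; last first.
  by rewrite !mxE offdiag // offdiag0 // subrr mulr0.
rewrite (bigD1 u) //= [X in _ + X]big1 ?addr0 => [|p np]; last first.
  by rewrite summxE big1 // => q _; rewrite !mxE [u == p]eq_sym (negPf np) andbF mulr0.
rewrite summxE (bigD1 v) //= big1 => [|q /andP[_ nq]].
  by rewrite !mxE !eqxx mulr1 addr0.
by rewrite !mxE eq_sym (negPf nq) mulr0.
Qed.

Lemma Mcomb_of (A : 'M[C]_a) : \tr A = 0 -> exists m, inspan M m /\
  forall v u, Lam (zbr v) u m = A v u.
Proof.
move=> /mxcomb_surj e; exists (Mcomb len (fun j => A j j) (fun p q => A q p)).
by split=> [|v u]; [apply: Mcomb_span|rewrite Lam_Mcomb e].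
Qed.

Lemma inSub_M d : parallel d -> (forall i, (1 < len i)%N -> bsum i d = 0) ->
  (forall s u, nZ s -> Lam s u d = 0) -> \sum_u Lam (zbr u) u d = 0 -> inSub M d.
Proof.
move=> pd h1 h2 h3; have [|m [hm hL]] := @Mcomb_of (\matrix_(v, u) Lam (zbr v) u d).
  by rewrite -[RHS]h3; apply: eq_bigr => u _; rewrite mxE.
have [dm bm zm _] := M_coord tH hm.
exists m; split=> //; apply: (hheq_coord tH) => //; first by case: dm.
  by move=> i l1; rewrite h1 ?bm.
by move=> s u /(good_cases tH)[ns|[v ->]]; [rewrite h2 ?zm|rewrite hL mxE].
Qed.

Lemma M_subalgebra : is_subalgebra mono B M.
Proof.
move=> l l' /(M_coord tH)[hl b z t] /(M_coord tH)[hl' b' z' t'].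
have [pl pl'] := (hl.1, hl'.1).
apply: inSub_M => [|i l1|s u ns|]; first exact: (parallel_br tH).
- by rewrite (bsum_br tH).
- have l1 := nZ_len ns; have gs := nZ_good ns.
  rewrite Lam_br // l1 b // b' // !mul0r subrr addr0 big1 // => w _.
  by rewrite (z s w ns) (z' s w ns) !mul0r subrr.
rewrite (eq_bigr _ (fun u _ => Lam_br_zbr tH u u hl hl')).
(* The trace of a commutator: exchanging the two sums turns one product into the other. *)
rewrite exchange_big /=.
rewrite (eq_bigr (fun w => \sum_u Lam (zbr u) w l * Lam (zbr w) u l' -
                         \sum_u Lam (zbr u) w l' * Lam (zbr w) u l)) => [|w _]; last by rewrite sumrB.
rewrite sumrB [X in _ - X]exchange_big /= -sumrB big1 // => w _.
by rewrite -sumrB big1 // => u _; rewrite mulrC subrr.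
Qed.

(** Rows of [Lam] are indexed by good branches, where the S_i of y vanish because such branches have
    no monomial relation. *)
Lemma C1_central y d : inspan C1 y -> isDer d -> hheq (br y d) 0.
Proof.
move=> /(Y_coord tH)[hy b z] hd; have [py pd] := (hy.1, hd.1).
apply: (hheq_coord tH); [exact: (parallel_br tH)|exact: parallel0|..].
  by move=> i l1; rewrite (bsum_br tH) // bsum0.
move=> s u gs; rewrite Lam_br // Lam0 big1 => [|w _]; last by rewrite !z !mul0r mulr0 subrr.
have /andP[ms _] := gs.
by rewrite b // z mul0r mulr0 subrr if_same addr0.
Qed.

(** The diagonal of the Z-block comes from m alone and sums to zero, so k = 0. Then y and l have S_i
    on disjoint sets of branches, and m and l have [Lam] on disjoint sets of rows. *)
Lemma sum_direct y m l : inspan C1 y -> inspan M m -> inspan L l ->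
  hheq (y + m + l) 0 -> [/\ hheq y 0, hheq m 0 & hheq l 0].
Proof.
move=> /(Y_coord tH)[hy yb yL] /(M_coord tH)[hm mb mZ mt] /(L_coord tH)[hl lb lL].
have [py [pm pl]] := (hy.1, (hm.1, hl.1)).
have ps : parallel (y + m + l) by apply: parallelD => //; apply: parallelD.
case/(hheq0P tH ps) => k [h1 h2].
have hmk v u : Lam (zbr v) u m = k * (v == u)%:R.
  rewrite -(inj_eq (zbr_inj tH)) -h2 ?(good_zbr tH) // !LamD yL lL.
  by rewrite addr0 add0r.
have k0 : k = 0.
  move: mt; rewrite (eq_bigr (fun=> k)) => [|u _]; last by rewrite hmk eqxx mulr1.
  rewrite sumr_const card_ord -mulr_natr => /eqP; rewrite mulf_eq0.
  by rewrite (negPf aC_neq0) orbF => /eqP.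
have hb i : (1 < len i)%N -> bsum i y + bsum i l = 0.
  by move=> l1; rewrite -k0 -(h1 i l1) !bsumD (mb i l1) addr0.
have yb0 i : (1 < len i)%N -> bsum i y = 0.
  move=> l1; case: (boolP (hasmono i)) => [mi|]; last exact: yb.
  by have := hb i l1; rewrite (lb i mi) addr0.
have lb0 i : (1 < len i)%N -> bsum i l = 0.
  by move=> l1; have := hb i l1; rewrite yb0 // add0r.
have p0 : parallel (0 : DerD len) by exact: parallel0.
split; apply: (hheq_coord tH) => //.
- by move=> i l1; rewrite yb0 // bsum0.
- by move=> s u _; rewrite yL Lam0.
- by move=> i l1; rewrite mb // bsum0.
- move=> s u /(good_cases tH)[ns|[v ->]]; first by rewrite mZ // Lam0.
  by rewrite hmk k0 mul0r Lam0.
- by move=> i l1; rewrite lb0 // bsum0.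
move=> s u /(good_cases tH)[ns|[v ->]]; last by rewrite lL Lam0.
have := h2 s u (nZ_good ns); rewrite !LamD yL mZ // k0 mul0r add0r add0r => ->.
by rewrite Lam0.
Qed.

(** * Every derivation is a combination of generators *)

Local Notation conn := (connect (Qedge mono B)).

Lemma conn_sym : connect_sym (Qedge mono B).
Proof.
apply: sym_connect_sym => i j; rewrite /Qedge andbCA; congr (_ && (_ && _)).
by apply: eq_existsb => r; rewrite andbC.
Qed.

(* Each component of Q_rho occurs once for each of its vertices, hence the averaging. *)
Lemma tcomb_coord (F : 'I_N -> C) : (forall i j, conn i j -> F i = F j) ->
  exists t, inspan S1 t /\ forall i, Qv mono i -> bsum i t = F i.
Proof.
move=> hF; pose n i := #|[pred j | Qv mono j && conn j i]|.
exists (\sum_(i | Qv mono i) (F i / (n i)%:R) *: tgen mono B i); split=> [|j Qj].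
  by apply: inspan_sum => i Qi; apply: inspan_gen; exists i.
have nE i : conn i j -> n i = n j.
  move=> cij; apply: eq_card => x; rewrite !inE; congr (_ && _).
  exact: (same_connect_r conn_sym cij).
rewrite bsum_sum (eq_bigr (fun i => if conn i j then F j / (n j)%:R else 0)) => [|i Qi].
  rewrite -big_mkcondr sumr_const -(mulr_natr (F j / _)) -[#|_|]/(n j) mulfVK //.
  have : (0 < n j)%N by apply/card_gt0P; exists j; rewrite inE Qj connect0.
  by case: (n j) => // m _; apply: natC_neq0.
rewrite bsumZ (bsum_first tH) /= Qj /=; case: ifP => cij; last by rewrite mulr0.
by rewrite mulr1 (hF i j) // nE.
Qed.

Lemma ycomb_coord (F : 'I_N -> C) :
  exists y, inspan C1 y /\ forall i, hasmono i -> bsum i y = F i.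
Proof.
exists (\sum_(i | hasmono i) F i *: ygen len i); split=> [|j mj].
  by apply: inspan_sum => i mi; apply: inspan_gen; exists i.
rewrite bsum_sum (bigD1 j) //= big1 => [|i /andP[_ nij]].
  by rewrite bsumZ (bsum_first tH) /= eqxx mulr1 addr0.
by rewrite bsumZ (bsum_first tH) /= eq_sym (negPf nij) mulr0.
Qed.

(** The coordinates are matched in four independent groups: S_i with monomial relations by y, the
    other S_i by t (they are constant on components), the traceless Z-block by m, the rows below it
    by z. *)
Lemma generation d : isDer d -> inSub (fun b => C1 b \/ M b \/ L b) d.
Proof.
move=> hd; have pd := hd.1.
(* The shift that makes the Z-block traceless; an inner derivation shifts the S_i by the same
   amount, so k is subtracted from them too. *)
pose k := (\sum_u Lam (zbr u) u d) / a%:R.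
pose A : 'M[C]_a := \matrix_(v, u) (Lam (zbr v) u d - k * (v == u)%:R).
have [|m [hm mE]] := @Mcomb_of A.
  rewrite /mxtrace (eq_bigr (fun u => Lam (zbr u) u d - k)) => [|u _]; last first.
    by rewrite mxE eqxx mulr1.
  by rewrite sumrB sumr_const card_ord -(mulr_natr k) mulfVK ?aC_neq0 ?subrr.
have [y [hy yE]] := ycomb_coord (fun i => bsum i d - k).
have [|t [ht tE]] := @tcomb_coord (fun i => bsum i d - k).
  by move=> i j cij; rewrite (bsum_connect tH hd cij).
have [hz zE] := zcomb_coord tH (fun s u => Lam s u d).
set z := \sum_u _ in hz zE.
have [[dy yb yL] [dm mb mZ _]] := (Y_coord tH hy, M_coord tH hm).
have [[dt tb tL] [dz zb zL]] := (T_coord tH ht, Z_coord tH hz).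
exists (y + m + t + z); split.
  apply: inspanD; last by apply: inspanS hz => e he; right; right; right.
  apply: inspanD; last by apply: inspanS ht => e he; right; right; left.
  apply: inspanD; last by apply: inspanS hm => e he; right; left.
  by apply: inspanS hy => e he; left.
have pe : parallel (y + m + t + z).
  by do ![apply: parallelD]; [case: dy|case: dm|case: dt|case: dz].
apply/(hheqP tH pd pe); exists k; split=> [i l1|s u gs].
  rewrite !bsumD mb // zb // !addr0; case: (boolP (hasmono i)) => mi.
    by rewrite yE // tb // addr0 subrK.
  by rewrite yb // tE ?add0r ?subrK // /Qv l1.
rewrite !LamD yL tL add0r addr0; case: (good_cases tH gs) => [ns|[v ->]].
  by rewrite mZ // zE // (nZ_neq tH) // mulr0 addr0 add0r.
by rewrite mE zL addr0 mxE (inj_eq (zbr_inj tH)) subrK.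
Qed.

(** Vanishing in HH^1 makes the matrix scalar, and a scalar matrix of trace zero is zero in
    characteristic 0. *)
Lemma Mcomb_eq0 dx ew : hheq (Mcomb len dx ew) 0 <-> mxcomb dx ew = 0.
Proof.
have [hm mb mZ _] := M_coord tH (Mcomb_span dx ew).
have pm := hm.1; split=> [/(hheq0P tH pm)[k [_ h2]]|e0].
  have e v u : mxcomb dx ew v u = k * (v == u)%:R.
    by rewrite -Lam_Mcomb h2 ?(good_zbr tH) // (inj_eq (zbr_inj tH)).
  have /eqP := mxcomb_trace dx ew.
  rewrite /mxtrace (eq_bigr (fun=> k)) => [|u _]; last by rewrite e eqxx mulr1.
  rewrite sumr_const card_ord -mulr_natr mulf_eq0 (negPf aC_neq0) orbF => /eqP k0.
  by apply/matrixP => v u; rewrite e k0 mul0r mxE.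
apply: (hheq_coord tH) => //; first exact: parallel0.
  by move=> i l1; rewrite mb // bsum0.
move=> s u /(good_cases tH)[ns|[v ->]]; first by rewrite mZ // Lam0.
by rewrite Lam_Mcomb e0 mxE Lam0.
Qed.

Lemma Mcomb_br dx dx' dx'' ew ew' ew'' :
  mxcomb dx'' ew'' = mxcomb dx ew *m mxcomb dx' ew' - mxcomb dx' ew' *m mxcomb dx ew ->
  hheq (br (Mcomb len dx ew) (Mcomb len dx' ew')) (Mcomb len dx'' ew'').
Proof.
(* Only the coordinates of the three combinations matter from here on, so their explicit form is
   forgotten. *)
move=> e; move: (Mcomb_span dx ew) (Mcomb_span dx' ew') (Mcomb_span dx'' ew'').
move: (Lam_Mcomb dx ew) (Lam_Mcomb dx' ew') (Lam_Mcomb dx'' ew'').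
move: (Mcomb len dx ew) (Mcomb len dx' ew') (Mcomb len dx'' ew'') => m m' m'' E E' E''.
move=> /(M_coord tH)[h b z _] /(M_coord tH)[h' b' z' _] /(M_coord tH)[h'' b'' z'' _].
have [p [p' p'']] := (h.1, (h'.1, h''.1)).
apply: (hheq_coord tH) => //; first exact: (parallel_br tH).
  by move=> i l1; rewrite (bsum_br tH) // b''.
move=> s u gs; case: (good_cases tH gs) => [ns|[v ->]].
  have l1 := nZ_len ns.
  rewrite (z'' s u ns) (Lam_br tH u h h' gs) l1 (b s l1) (b' s l1) !mul0r subrr addr0.
  by apply: big1 => w _; rewrite (z s w ns) (z' s w ns) !mul0r subrr.
rewrite (Lam_br_zbr tH v u h h') E'' e !mxE -sumrB.
by apply: eq_bigr => w _; rewrite !E !E'.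
Qed.

End Decomposition.

Theorem theorem6p5 (N : nat) (len : 'I_N -> nat)
  (nm : nat) (mono : 'I_nm -> 'I_N * 'I_(K len).+1 * 'I_(K len).+1)
  (nn : nat) (B : 'M[C]_(nn, N)) (kp : 'I_nn -> 'I_N) (a : nat) :
  toupie_hyp mono B kp a ->
  D_gt1 mono B ->
  let hh := hheq mono B in
  let L := Lgen mono B kp a in
  let S1 := Tgen mono B in
  let L2 := Zgen mono kp a in
  let C1 := Ygen mono in
  let M := @Mgen N len a in
  (* the classes y_i, x_j, w_pq, t_h, z_us are elements of HH^1(A) *)
  (forall d, C1 d \/ M d \/ L d -> isDer mono B d) /\
  (* L is a solvable Lie ideal of HH^1(A) *)
  (is_ideal mono B L /\ is_solvable mono B L) /\
  (* (1) S1 abelian subalgebra, L2 abelian ideal, L = S1 |x L2 *)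
  [/\ is_abelian mono B S1 /\ is_subalgebra mono B S1,
      is_abelian mono B L2 /\ is_ideal mono B L2 &
      (forall s l, inspan S1 s -> inspan L2 l -> hh s l -> hh s 0)] /\
  (* (2) HH^1(A) = <C''_1> (+) (sl_a |x (S1 |x L2)) *)
  [/\ (forall d, isDer mono B d -> inSub mono B (fun b => C1 b \/ M b \/ L b) d),
      (forall y m l, inspan C1 y -> inspan M m -> inspan L l ->
         hh (y + m + l) 0 -> [/\ hh y 0, hh m 0 & hh l 0]),
      is_subalgebra mono B C1 /\
      (forall y d, inspan C1 y -> inspan (fun b => M b \/ L b) d -> hh (br y d) 0),
      is_subalgebra mono B M &
      (* <x_j, w_pq> is isomorphic to sl_a via x_j |-> E_jj - E_11, w_pq |-> E_qp *)
      [/\ (forall (dx : 'I_a -> C) (ew : 'I_a -> 'I_a -> C), \tr (mxcomb dx ew) = 0),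
          (forall (dx : 'I_a -> C) (ew : 'I_a -> 'I_a -> C),
             hh (Mcomb len dx ew) 0 <-> mxcomb dx ew = 0),
          (forall A : 'M[C]_a, \tr A = 0 -> exists dx ew, mxcomb dx ew = A) &
          (forall (dx dx' dx'' : 'I_a -> C) (ew ew' ew'' : 'I_a -> 'I_a -> C),
             mxcomb dx'' ew'' = mxcomb dx ew *m mxcomb dx' ew'
                                - mxcomb dx' ew' *m mxcomb dx ew ->
             hh (br (Mcomb len dx ew) (Mcomb len dx' ew')) (Mcomb len dx'' ew''))]].
Proof.
move=> tH _ hh L S1 L2 C1 M.
have derML d : inspan (fun b => M b \/ L b) d -> isDer mono B d.
  by apply: (isDer_span tH) => e he; apply: (gen_isDer tH); right.
split; first exact: (gen_isDer tH).
split; first by split; [exact: (L_ideal tH)|exact: (L_solvable tH)].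
split; first split.
- by split; [|apply: abelian_subalgebra]; exact: (S1_abelian tH).
- by split; [exact: (L2_abelian tH)|exact: (L2_ideal tH)].
- exact: (S1_L2_disjoint tH).
split.
- exact: (generation tH).
- exact: (sum_direct tH).
- split=> [y y' hy /(Y_coord tH)[hy' _ _]|y d hy /derML hd].
    by apply: inSub_hheq0; apply: (C1_central tH).
  exact: (C1_central tH).
- exact: (M_subalgebra tH).
split.
- exact: (mxcomb_trace tH).
- exact: (Mcomb_eq0 tH).
- by move=> A trA; exists (fun j => A j j), (fun p q => A q p); apply: (mxcomb_surj tH).
- exact: (Mcomb_br tH).
Qed.
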